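(* Consider the equivalences $D^b_G(\mathrm{Coh}\,X)\cong D^b(\mathrm{mod}\,A_3^{\otimes 5})\cong \mathrm{FS}(F)$ and the heart $\mathrm{mod}\,A_3^{\otimes 5}$. For all finite $x$ sufficiently close to the Gepner point $x=\infty$ (with a fixed branch of $x^{-1/5}$), there is a stability condition on the heart $\mathrm{mod}\,A_3^{\otimes 5}$ with central charge $Z_x$ (the central charge of quintic periods, analytically continued to near $x=\infty$) such that each stable object is isomorphic, under these equivalences, to a Lagrangian vanishing cycle and to a shift of an equivariant coherent sheaf of the Beilinson basis.
   Context: **Categories.** $X=\{x_1^5+\dots+x_5^5=0\}\subset\mathbb P^4_{\mathbb C}$; $\xi=\exp(2\pi i/5)$; $G\cong\mathbb Z_5^5/\mathbb Z_5$ acts on $\mathbb P^4$ by multiplying coordinates by powers of $\xi$ (modulo common multiplication). $D^b_G(\mathrm{Coh}\,X)$ is the bounded derived category of $G$-equivariant coherent sheaves. In this convention $A_n$ is the type-$A$ Dynkin quiver with $n+1$ vertices and one-way arrows, so $A_3$ is $0\to1\to2\to3$. The quiver $A_3^{\otimes5}$ has vertices $s=\{s_1,\dots,s_5\}$, $0\le s_i\le 3$, an arrow $s\to s'$ whenever $s'$ is obtained from $s$ by raising one $s_i$ by $1$, and the relations that all squares commute; $\mathrm{mod}\,A_3^{\otimes 5}$ is its category of finite-dimensional complex representations, the standard heart of $D^b(\mathrm{mod}\,A_3^{\otimes5})$. The simple representation with $\mathbb C$ at vertex $s$ is also written $s$. $F=x_1^5+\dots+x_5^5:\mathbb C^5\to\mathbb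 C$, and $\mathrm{FS}(F)$ is the derived Fukaya–Seidel category defined by Lagrangian vanishing cycles in the regular zero locus of a morsification of $F$ (built from A'Campo's morsifications of the $x_i^5$). The following is known: $D^b_G(\mathrm{Coh}\,X)\cong D^b(\mathrm{mod}\,A_3^{\otimes5})\cong\mathrm{FS}(F)$; the simple representations $s$ correspond to the Lagrangian vanishing cycles in $\mathrm{FS}(F)$; and after forgetting the equivariance $s$ becomes $\tau^{-\sum s_i}(\mathcal O_X)$, where $\tau(E)=\mathcal O(1)\otimes T_{\mathcal O_X}(E)$, $T_{\mathcal O_X}$ is the spherical twist, and $\tau^5\cong[2]$. The Beilinson basis consists of the objects $\tau^i(\mathcal O_X)[-i]$; up to shifts, $\tau^i(\mathcal O_X)$ for $i=0,\dots,4$ are $\mathcal O_X,\mathcal O_X(1),\Omega(2),\Omega^2(3),\Omega^3(4)$, with $\Omega^n$ the restriction to $X$ of the $n$-th exterior power of the cotangent bundle of $\mathbb P^4$. **Central charge.** Near $x=0$, $Z_x(E)=\int_X \mathrm{ch}(E)\,w(x,\tfrac{J}{2\pi i})\,\mathrm{Todd}\,X$ with $w(x,p)=\sum_{n\ge0}\frac{\Gamma(1+5(n+p))}{\Gamma(1+(n+p))^5}x^{n+p}$, $J$ the hyperplane class, equivariance being forgotten; so $Z_x(s)=Z_x(\tau^{-\sum s_i}(\mathcal O_X))$. Its analytic continuation to near $x=\infty$ is given explicitly (up to an overall sign common to all objects) as follows. Put $$\tilde\omega_k(x)=-\frac15\frac1{(2\pi i)^4}\sum_{N\ge0}\frac{\Gamma(N+\frac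 k5)^5}{\Gamma(5N+k)}x^{-N-\frac k5},\qquad \omega_j^\infty(x)=\sum_{k=1}^5(1-\xi^k)^4\xi^{kj}\tilde\omega_k(x),$$ $\Pi_B^\infty(x)={}^t(\omega_0^\infty,\omega_1^\infty,\omega_2^\infty,\omega_4^\infty)$, and $$N=\begin{pmatrix}1&0&0&0\\-\frac25&\frac25&\frac15&-\frac15\\-\frac{21}5&\frac15&\frac35&-\frac85\\1&-1&0&0\end{pmatrix},\qquad M=\begin{pmatrix}0&1&0&0\\0&0&1&0\\-1&-1&-1&-1\\1&0&0&0\end{pmatrix}.$$ Then $Z_x(s)$ is the fourth component of $N M^{\sum s_i}\Pi_B^\infty(x)$. **Stability condition.** A stability condition on a triangulated category $\mathcal T$ consists of a heart $\mathcal A$ of a bounded $t$-structure and a homomorphism $Z:K(\mathcal T)\to\mathbb C$ (central charge), with a family of nonzero semistable objects of $\mathcal A$ such that: (1) each semistable $Q\in\mathcal A$ has $Z(Q)=m(Q)\exp(\phi_Q i)$ with mass $m(Q)>0$ and phase $\phi_Q\in\mathbb R$; (2) if $\mathrm{Ext}^1(Q,Q')\ne0$ for semistable $Q,Q'$, then $|\phi_Q-\phi_{Q'}|<\pi$; (3) if $\phi_{Q'}>\phi_Q$ then $\mathrm{Hom}(Q',Q)=0$; (4) each nonzero $E\in\mathcal A$ has a filtration $0=E_n\subset E_{n-1}\subset\dots\subset E_0=E$ in $\mathcal A$ with semistable quotients $Q_i=E_i/E_{i+1}$ and $\phi_{Q_{i+1}}>\phi_{Q_i}$. A semistable object is stable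 if it is not a non-trivial extension of semistable objects of its phase. (Central charges of objects of $\mathcal A$ need not lie in a half-plane.) *)

(* Defs.v *)
From HB Require Import structures.
From mathcomp Require Import all_boot all_order all_algebra.
From mathcomp Require Import complex.
From mathcomp Require Import all_classical all_reals all_analysis.
Import Order.TTheory GRing.Theory Num.Theory.
Import numFieldNormedType.Exports.

Set Implicit Arguments.
Unset Strict Implicit.
Unset Printing Implicit Defensive.

Local Open Scope classical_set_scope.
Local Open Scope ring_scope.
Local Open Scope complex_scope.

(* Hom-sets carry their own equality [heq], so that localizations need no
   quotient types. [comp f g] is in diagrammatic order. *)
Record category := Category {
  ob :> Type;
  hom : ob -> ob -> Type;
  heq : forall X Y, hom X Y -> hom X Y -> Prop;
  idm : forall X, hom X X;
  comp : forall X Y Z, hom X Y -> hom Y Z -> hom X Z;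
  heq_refl : forall X Y (f : hom X Y), heq f f;
  heq_sym : forall X Y (f g : hom X Y), heq f g -> heq g f;
  heq_trans : forall X Y (f g h : hom X Y), heq f g -> heq g h -> heq f h;
  comp_heq : forall X Y Z (f f' : hom X Y) (g g' : hom Y Z),
    heq f f' -> heq g g' -> heq (comp f g) (comp f' g');
  comp1m : forall X Y (f : hom X Y), heq (comp (idm X) f) f;
  compm1 : forall X Y (f : hom X Y), heq (comp f (idm Y)) f;
  compmA : forall X Y Z T (f : hom X Y) (g : hom Y Z) (h : hom Z T),
    heq (comp f (comp g h)) (comp (comp f g) h) }.

Definition isom (C : category) (X Y : C) : Prop :=
  exists (f : hom X Y) (g : hom Y X),
    heq (comp f g) (idm X) /\ heq (comp g f) (idm Y).

Record functor (C D : category) := Functor {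
  fob :> C -> D;
  fmap : forall X Y, hom X Y -> hom (fob X) (fob Y);
  fmap_heq : forall X Y (f g : hom X Y), heq f g -> heq (fmap f) (fmap g);
  fmap1 : forall X, heq (fmap (idm X)) (idm (fob X));
  fmap_comp : forall X Y Z (f : hom X Y) (g : hom Y Z),
    heq (fmap (comp f g)) (comp (fmap f) (fmap g)) }.

Definition id_functor (C : category) : functor C C.
Proof.
exists (fun X => X) (fun _ _ f => f) => //.
- by move=> X; exact: heq_refl.
- by move=> X Y Z f g; exact: heq_refl.
Defined.

Definition comp_functor (C D E : category) (G : functor D E) (F : functor C D) :
  functor C E.
Proof.
exists (fun X => G (F X)) (fun X Y f => fmap G (fmap F f)).
- by move=> X Y f g fg; do 2 apply: fmap_heq.
- by move=> X; apply: heq_trans (fmap1 G _); apply/fmap_heq/fmap1.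
- by move=> X Y Z f g; apply: heq_trans (fmap_comp G _ _); apply/fmap_heq/fmap_comp.
Defined.

Definition functor_pow (C : category) (F : functor C C) (n : nat) : functor C C :=
  iter n (comp_functor F) (id_functor C).

Definition nat_isom (C D : category) (F G : functor C D) : Prop :=
  exists (a : forall X, hom (F X) (G X)) (b : forall X, hom (G X) (F X)),
    (forall X, heq (comp (a X) (b X)) (idm (F X)) /\
               heq (comp (b X) (a X)) (idm (G X))) /\
    (forall X Y (f : hom X Y), heq (comp (fmap F f) (a Y)) (comp (a X) (fmap G f))).

Definition is_equivalence (C D : category) (F : functor C D) : Prop :=
  [/\ forall X Y (f g : hom X Y), heq (fmap F f) (fmap F g) -> heq f g,
      forall X Y (h : hom (F X) (F Y)), exists f : hom X Y, heq (fmap F f) h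
    & forall Y, exists X, isom (F X) Y].

Record shift_category := ShiftCategory {
  shift_cat :> category;
  shift_functor : functor shift_cat shift_cat;
  shift_equiv : is_equivalence shift_functor }.

(* X is isomorphic to Y[k] for some integer k = b - a. *)
Definition isom_to_shift (C : shift_category) (X Y : C) : Prop :=
  exists a b : nat, isom (functor_pow (shift_functor C) a X) (functor_pow (shift_functor C) b Y).

(* Gabriel-Zisman localization: zigzags built from the morphisms of C and
   formal inverses of the morphisms in W, modulo the generated congruence. *)
Section Localization.
Variables (C : category) (W : forall X Y : C, hom X Y -> Prop).

Inductive zigzag : C -> C -> Type :=
| zz_hom X Y of hom X Y : zigzag X Y
| zz_inv X Y (f : hom X Y) of W f : zigzag Y X
| zz_comp X Y Z of zigzag X Y & zigzag Y Z : zigzag X Z.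

Inductive zz_eq : forall X Y, zigzag X Y -> zigzag X Y -> Prop :=
| zz_refl X Y (f : zigzag X Y) : zz_eq f f
| zz_sym X Y (f g : zigzag X Y) : zz_eq f g -> zz_eq g f
| zz_trans X Y (f g h : zigzag X Y) : zz_eq f g -> zz_eq g h -> zz_eq f h
| zz_cong X Y Z (f f' : zigzag X Y) (g g' : zigzag Y Z) :
    zz_eq f f' -> zz_eq g g' -> zz_eq (zz_comp f g) (zz_comp f' g')
| zz_comp1m X Y (f : zigzag X Y) : zz_eq (zz_comp (zz_hom (idm X)) f) f
| zz_compm1 X Y (f : zigzag X Y) : zz_eq (zz_comp f (zz_hom (idm Y))) f
| zz_compA X Y Z T (f : zigzag X Y) (g : zigzag Y Z) (h : zigzag Z T) :
    zz_eq (zz_comp f (zz_comp g h)) (zz_comp (zz_comp f g) h)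
| zz_hom_heq X Y (f g : hom X Y) : heq f g -> zz_eq (zz_hom f) (zz_hom g)
| zz_hom_comp X Y Z (f : hom X Y) (g : hom Y Z) :
    zz_eq (zz_hom (comp f g)) (zz_comp (zz_hom f) (zz_hom g))
| zz_invr X Y (f : hom X Y) (w : W f) :
    zz_eq (zz_comp (zz_hom f) (zz_inv w)) (zz_hom (idm X))
| zz_invl X Y (f : hom X Y) (w : W f) :
    zz_eq (zz_comp (zz_inv w) (zz_hom f)) (zz_hom (idm Y)).

Definition localization : category :=
  @Category C zigzag zz_eq (fun X => zz_hom (idm X)) zz_comp
    zz_refl zz_sym zz_trans zz_cong zz_comp1m zz_compm1 zz_compA.
End Localization.

Definition vertex := {ffun 'I_5 -> 'I_4}.

Definition vsum (s : vertex) : nat := (\sum_i s i)%N.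

Definition arrow (s t : vertex) : bool :=
  [exists i, forall j, (t j == s j + (j == i) :> nat)%N].

(* Vectors are rows and maps act on them from the right, so composition along
   a path s -> t -> u is [rmap st *m rmap tu]. Two distinct paths of length 2
   with the same endpoints are the two sides of a square. *)
Record rep (K : fieldType) := Rep {
  rdim : vertex -> nat;
  rmap : forall s t, arrow s t -> 'M[K]_(rdim s, rdim t);
  rep_comm : forall s t t' u (st : arrow s t) (tu : arrow t u)
                    (st' : arrow s t') (t'u : arrow t' u),
    rmap st *m rmap tu = rmap st' *m rmap t'u }.

Record rhom (K : fieldType) (E E' : rep K) := RHom {
  rfun :> forall s, 'M[K]_(rdim E s, rdim E' s);
  rhom_comm : forall s t (st : arrow s t),
    rmap E st *m rfun t = rfun s *m rmap E' st }.

Section Mod.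
Variable K : fieldType.
Implicit Types E Q : rep K.

Definition rhom_id E : rhom E E.
Proof. by exists (fun s => 1%:M) => s t st; rewrite mulmx1 mul1mx. Defined.

Definition rhom_comp E E' E'' (f : rhom E E') (g : rhom E' E'') : rhom E E''.
Proof.
exists (fun s => f s *m g s) => s t st.
by rewrite mulmxA rhom_comm -!mulmxA rhom_comm.
Defined.

Definition rhom_zero E E' : rhom E E'.
Proof. by exists (fun s => 0) => s t st; rewrite mulmx0 mul0mx. Defined.

Definition mod_cat : category.
Proof.
apply: (@Category (rep K) (@rhom K) (fun E E' f g => forall s, f s = g s)
          rhom_id rhom_comp) => //=.
- by move=> X Y f g h fg gh s; rewrite fg gh.
- by move=> X Y Z f f' g g' ff' gg' s; rewrite ff' gg'.
- by move=> X Y f s; rewrite mul1mx.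
- by move=> X Y f s; rewrite mulmx1.
- by move=> X Y Z T f g h s; rewrite mulmxA.
Defined.

Definition rep_isom E E' : Prop := @isom mod_cat E E'.

Definition rep_is0 E : Prop := forall s, rdim E s = 0%N.

Definition rep_zero : rep K.
Proof. by exists (fun=> 0%N) (fun s t _ => 0). Defined.

Definition simple (s : vertex) : rep K.
Proof.
exists (fun t => (t == s) : nat) (fun t u _ => 0).
by move=> *; rewrite !mulmx0.
Defined.

Definition short_exact E' E E'' (f : rhom E' E) (g : rhom E E'') : Prop :=
  forall s, [/\ row_free (f s), row_full (g s) & (f s == kermx (g s))%MS].

Definition hom_eq0 Q Q' : Prop := forall (f : rhom Q Q') s, f s = 0.

(* Ext^1(Q, Q') <> 0 in the sense of Yoneda: some extension of Q by Q' does
   not split. *)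
Definition ext1_neq0 Q Q' : Prop :=
  exists (E : rep K) (f : rhom Q' E) (g : rhom E Q),
    short_exact f g /\ ~ exists h : rhom Q E, forall s, h s *m g s = 1%:M.

(* The differential is indexed by all pairs of degrees and vanishes unless the
   second is the successor of the first. *)
Record cplx := Cplx {
  cob : int -> rep K;
  cdiff : forall m n, rhom (cob m) (cob n);
  cdiff_shape : forall m n s, n != m + 1 -> cdiff m n s = 0;
  cdiff_sq : forall m n p s, cdiff m n s *m cdiff n p s = 0;
  cplx_bounded : exists b : nat, forall n : int, (b < `|n|)%N -> rep_is0 (cob n) }.

Record chain_map (X Y : cplx) := ChainMap {
  cfun :> forall n, rhom (cob X n) (cob Y n);
  cfun_comm : forall m n s, cdiff X m n s *m cfun n s = cfun m s *m cdiff Y m n s }.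

Definition chain_id X : chain_map X X.
Proof. by exists (fun n => rhom_id _) => m n s /=; rewrite mulmx1 mul1mx. Defined.

Definition chain_comp X Y Z (f : chain_map X Y) (g : chain_map Y Z) : chain_map X Z.
Proof.
exists (fun n => rhom_comp (f n) (g n)) => m n s /=.
by rewrite mulmxA cfun_comm -!mulmxA cfun_comm.
Defined.

Definition cplx_cat : category.
Proof.
apply: (@Category cplx chain_map (fun X Y f g => forall n s, f n s = g n s)
          chain_id chain_comp) => //=.
- by move=> X Y f g h fg gh n s; rewrite fg gh.
- by move=> X Y Z f f' g g' ff' gg' n s; rewrite ff' gg'.
- by move=> X Y f n s; rewrite mul1mx.
- by move=> X Y f n s; rewrite mulmx1.
- by move=> X Y Z T f g h n s; rewrite mulmxA.
Defined.

Definition is_cycle (X : cplx) n s (v : 'rV[K]_(rdim (cob X n) s)) : Prop :=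
  v *m cdiff X n (n + 1) s = 0.

Definition is_boundary (X : cplx) n s (v : 'rV[K]_(rdim (cob X n) s)) : Prop :=
  exists w : 'rV[K]_(rdim (cob X (n - 1)) s), v = w *m cdiff X (n - 1) n s.

(* Bijectivity of the induced map on cohomology, at each degree and vertex. *)
Definition quasi_iso (X Y : cplx_cat) (f : hom X Y) : Prop :=
  forall n s,
    (forall v : 'rV_(rdim (cob X n) s),
       is_cycle v -> is_boundary (v *m cfun f n s) -> is_boundary v) /\
    (forall w : 'rV_(rdim (cob Y n) s), is_cycle w ->
       exists2 v : 'rV_(rdim (cob X n) s),
         is_cycle v & is_boundary (v *m cfun f n s - w)).

Definition Db : category := localization quasi_iso.

(* Image of E under the inclusion of the standard heart. *)
Definition heart (E : rep K) : Db.
Proof.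
exists (fun n : int => if n == 0 then E else rep_zero) (fun m n => rhom_zero _ _) => //=.
- by move=> *; rewrite mulmx0.
- by exists 0%N => n; rewrite absz_gt0 => /negPf -> s.
Defined.

End Mod.

Section Stability.
Variable R : realType.
Implicit Types E Q : rep R[i].

Definition expi (t : R) : R[i] := cos t +i* sin t.

(* A homomorphism K(Db) -> C is the same as an additive function on the heart.
   The value of [phase] only matters on semistable objects. *)
Record stability := Stability {
  central_charge : rep R[i] -> R[i];
  charge_add : forall E' E E'' (f : rhom E' E) (g : rhom E E''),
    short_exact f g -> central_charge E = central_charge E' + central_charge E'';
  semistable : rep R[i] -> Prop;
  phase : rep R[i] -> R;
  semistable_neq0 : forall Q, semistable Q -> ~ rep_is0 Q;
  semistable_isom : forall Q Q', rep_isom Q Q' -> semistable Q -> semistable Q';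
  charge_phase : forall Q, semistable Q ->
    exists2 m : R, 0 < m & central_charge Q = m%:C * expi (phase Q);
  phase_ext1 : forall Q Q', semistable Q -> semistable Q' ->
    ext1_neq0 Q Q' -> `|phase Q - phase Q'| < pi;
  phase_hom : forall Q Q', semistable Q -> semistable Q' ->
    phase Q < phase Q' -> hom_eq0 Q' Q;
  filtration : forall E, ~ rep_is0 E ->
    exists (n : nat) (F Q : nat -> rep R[i])
           (incl : forall k, rhom (F k.+1) (F k)) (quot : forall k, rhom (F k) (Q k)),
      [/\ rep_isom (F 0%N) E, rep_is0 (F n),
          forall k, (k < n)%N -> short_exact (incl k) (quot k) /\ semistable (Q k)
        & forall k, (k.+1 < n)%N -> phase (Q k) < phase (Q k.+1)] }.

(* A non-trivial extension is one with both terms nonzero; semistable objects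
   are nonzero. *)
Definition stable (S : stability) (Q : rep R[i]) : Prop :=
  semistable S Q /\
  ~ exists (Q' Q'' : rep R[i]) (f : rhom Q' Q) (g : rhom Q Q''),
      [/\ semistable S Q', semistable S Q'', phase S Q' = phase S Q,
          phase S Q'' = phase S Q & short_exact f g].

(* Euler's integral, used at positive arguments only. *)
Definition Gamma (a : R) : R :=
  \int[lebesgue_measure]_(t in `]0, +oo[) (t `^ (a - 1) * expR (- t)).

Definition xi : R[i] := expi (2 * pi / 5).

(* Below, u stands for the chosen value of x^(-1/5), so that x^(-N-k/5) is
   u^(5N+k). *)
Definition omega_tilde (k : nat) (u : R[i]) : R[i] :=
  - (1 / 5) * (1 / (2 * pi%:C * 'i) ^+ 4) *
  lim ((fun n => \sum_(0 <= N < n)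
     (Gamma (N%:R + k%:R / 5) ^+ 5 / Gamma (5 * N + k)%:R)%:C
       * u ^+ (5 * N + k) : R[i]^o) @ \oo).

Definition omega_inf (j : nat) (u : R[i]) : R[i] :=
  \sum_(1 <= k < 6) (1 - xi ^+ k) ^+ 4 * xi ^+ (k * j) * omega_tilde k u.

Definition Pi_inf (u : R[i]) : 'cV[R[i]]_4 :=
  \col_i omega_inf (nth 0%N [:: 0; 1; 2; 4]%N i) u.

Definition mx4 (rows : seq (seq R[i])) : 'M[R[i]]_4 :=
  \matrix_(i, j) nth 0 (nth [::] rows i) j.

Definition matN : 'M[R[i]]_4 := mx4
  [:: [:: 1;          0;       0;       0];
      [:: - (2 / 5);  2 / 5;   1 / 5;   - (1 / 5)];
      [:: - (21 / 5); 1 / 5;   3 / 5;   - (8 / 5)];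
      [:: 1;          -1;      0;       0]].

Definition matM : 'M[R[i]]_4 := mx4
  [:: [:: 0;  1;  0;  0];
      [:: 0;  0;  1;  0];
      [:: -1; -1; -1; -1];
      [:: 1;  0;  0;  0]].

Definition quintic_charge (u : R[i]) (s : vertex) : R[i] :=
  (matN *m matM ^+ vsum s *m Pi_inf u) ord_max 0.

End Stability.

(* Main.v *)
(* Z_x(s) depends only on n = s_1 + ... + s_5 and equals omega_n - omega_(n+1)
   = sum_k (1 - xi^k)^5 xi^(kn) omega~_k.  Near the Gepner point the k = 1 term
   dominates, so with u = x^(-1/5) it is A u xi^n (1 + O(u)) with A <> 0: the phases
   theta_n stay within pi/5 of arg(A u) + 2 pi n / 5, hence strictly increase with n
   with consecutive gaps less than pi.  Arrows raise n by 1, so one may declare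
   semistable the nonzero representations supported on a single level n, with phase
   theta_n; extensions only link adjacent levels, and the filtration by levels is the
   Harder-Narasimhan filtration.  Such representations are sums of simples, so the
   stable objects are the simples. *)

Require Import Defs.
From mathcomp Require Import all_boot all_order all_algebra.
From mathcomp Require Import complex.
From mathcomp Require Import zify ring lra.
From mathcomp Require Import all_classical all_reals all_analysis.
From mathcomp Require Import measurable_realfun.
Import Order.TTheory GRing.Theory Num.Theory.
Import numFieldNormedType.Exports.
Local Open Scope classical_set_scope.
Local Open Scope ring_scope.
Local Open Scope complex_scope.

Set Implicit Arguments.
Unset Strict Implicit.
Unset Printing Implicit Defensive.

(** * Representations supported on one level *)

Lemma arrow_vsum s t : arrow s t -> vsum t = (vsum s).+1.
Proof.
case/existsP => i /forallP st; rewrite /vsum.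
under eq_bigr do rewrite (eqP (st _)).
by rewrite big_split/= -[in RHS]addn1 -big_mkcond/= big_pred1_eq.
Qed.

Section Reps.
Variable K : fieldType.
Implicit Types E Q : rep K.

Lemma rep_is0N E : ~ rep_is0 E -> exists s, rdim E s != 0%N.
Proof. by move=> /existsNP[s /eqP]; exists s. Qed.

(** [pid_mx] serves as a cast between matrix sizes that are provably but not definitionally
    equal. *)
Lemma pid_mxK m n : m = n -> (pid_mx m : 'M[K]_(m, n)) *m (pid_mx n : 'M[K]_(n, m)) = 1%:M.
Proof. by move=> ->; rewrite pid_mx_1 mulmx1. Qed.

Lemma isom_rdim E E' : rep_isom E E' -> forall s, rdim E s = rdim E' s.
Proof.
move=> [f [g [fg gf]]] s; apply/eqP; rewrite eqn_leq.
by rewrite (mulmx1_min (fg s)) (mulmx1_min (gf s)).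
Qed.

Lemma short_exact_rdim E' E E'' (f : rhom E' E) (g : rhom E E'') :
  short_exact f g -> forall s, rdim E s = (rdim E' s + rdim E'' s)%N.
Proof.
move=> fg s; have [/eqP rf /eqP rg /eqmxP fk] := fg s.
by rewrite -rf -rg fk mxrank_ker subnK// rank_leq_row.
Qed.

(** * Subquotients cut out by convex sets of vertices *)

Section Truncation.
Variables (E : rep K) (P : pred vertex).
Hypothesis P_convex : forall s t u, arrow s t -> arrow t u -> P s -> P u -> P t.

Definition trunc_dim s := if P s then rdim E s else 0%N.

(** Each [pid_mx] is an identity at a vertex of [P] and has an empty side elsewhere, which spares a
    cast along the test in [trunc_dim]. *)
Definition trunc_map s t (st : arrow s t) : 'M[K]_(trunc_dim s, trunc_dim t) :=
  pid_mx (trunc_dim s) *m rmap E st *m pid_mx (rdim E t).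

(** If an endpoint lies outside [P], both sides are empty matrices. Otherwise convexity puts both
    middle vertices in [P], and the square is one of [E]. *)
Lemma trunc_map_comm s t t' u (st : arrow s t) (tu : arrow t u)
    (st' : arrow s t') (t'u : arrow t' u) :
  trunc_map st *m trunc_map tu = trunc_map st' *m trunc_map t'u.
Proof.
have := P_convex st tu; have := P_convex st' t'u.
rewrite /trunc_map /trunc_dim.
case: (P s) => /=; last by move=> *; rewrite [LHS]flatmx0 [RHS]flatmx0.
case: (P u) => /=; last by move=> *; rewrite [LHS]thinmx0 [RHS]thinmx0.
case: (P t') => [_|/(_ isT isT)//]; case: (P t) => [_|/(_ isT isT)//].
by rewrite !pid_mx_1 !mul1mx !mulmx1; exact: rep_comm.
Qed.

Definition trunc : rep K := Rep trunc_map_comm.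

Lemma trunc_isom : (forall s, rdim E s != 0%N -> P s) -> rep_isom trunc E.
Proof.
move=> EP.
have D s : trunc_dim s = rdim E s.
  by rewrite /trunc_dim; case: ifP => // /negP Ps; case: eqP (EP s) => // _ /(_ isT).
unshelve eexists.
  exists (fun s => pid_mx (trunc_dim s)) => s t st /=.
  by rewrite /trunc_map -mulmxA pid_mxK// mulmx1.
unshelve eexists.
  exists (fun s => pid_mx (rdim E s)) => s t st /=.
  by rewrite /trunc_map !mulmxA pid_mxK// mul1mx.
by split=> s /=; rewrite pid_mxK.
Qed.
End Truncation.

Section TruncationMap.
Variables (E : rep K) (P P' : pred vertex).
Hypothesis P_convex : forall s t u, arrow s t -> arrow t u -> P s -> P u -> P t.
Hypothesis P'_convex : forall s t u, arrow s t -> arrow t u -> P' s -> P' u -> P' t.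
Hypothesis PP' : forall s t, arrow s t -> P s -> P' t -> P t = P' s.

(** Only the case [P s], [P' t] gives a nonempty matrix. One side then passes through the first
    truncation at [t], the other through the second at [s]; by [PP'] both are the map of [E] or both
    are zero. *)
Lemma trunc_hom_comm s t (st : arrow s t) :
  rmap (trunc E P_convex) st *m
    (pid_mx (rdim E t) : 'M[K]_(trunc_dim E P t, trunc_dim E P' t)) =
  (pid_mx (rdim E s) : 'M[K]_(trunc_dim E P s, trunc_dim E P' s)) *m
    rmap (trunc E P'_convex) st.
Proof.
have := PP' st; rewrite /= /trunc_map /trunc_dim.
case: (P s) => /=; last by move=> *; rewrite [LHS]flatmx0 [RHS]flatmx0.
case: (P' t) => /=; last by move=> *; rewrite [LHS]thinmx0 [RHS]thinmx0.
move=> /(_ isT isT) <-; case: (P t); first by rewrite !pid_mx_1 !mul1mx !mulmx1.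
by rewrite thinmx0 mul0mx [X in X *m _]thinmx0 mul0mx.
Qed.

Definition trunc_hom : rhom (trunc E P_convex) (trunc E P'_convex) :=
  @RHom _ (trunc E P_convex) (trunc E P'_convex)
    (fun s => pid_mx (rdim E s)) trunc_hom_comm.
End TruncationMap.

Lemma trunc_exact E (P1 P2 P3 : pred vertex) c1 c2 c3 h12 h23 :
  (forall s, P2 s = P1 s || P3 s) -> (forall s, ~~ (P1 s && P3 s)) ->
  short_exact (@trunc_hom E P1 P2 c1 c2 h12) (@trunc_hom E P2 P3 c2 c3 h23).
Proof.
move=> P2E P13 s; have := P2E s; have := P13 s; rewrite /= /trunc_dim.
case: (P1 s); case: (P3 s) => //= _ ->; rewrite ?pid_mx_1.
- by split; rewrite ?row_free_unit ?unitmx1 /row_full ?thinmx0 ?mxrank0 ?kermx0 ?submx_refl//.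
- split; rewrite ?row_full_unit ?unitmx1 /row_free ?flatmx0 ?mxrank0//.
  have /eqP-> : kermx (1%:M : 'M[K]_(rdim E s)) == 0 by rewrite kermx_eq0 row_free_unit unitmx1.
  by rewrite !sub0mx.
- by split; rewrite /row_free /row_full ?mxrank0 ?flatmx0 ?thinmx0 ?sub0mx ?mxrank0//.
Qed.

End Reps.

Section Levels.
Variable K : fieldType.
Implicit Types E Q : rep K.

Lemma mx_dim0 m n (A : 'M[K]_(m, n)) : m = 0%N \/ n = 0%N -> A = 0.
Proof. by case=> ?; subst; [exact: flatmx0 | exact: thinmx0]. Qed.

(** The maximum only makes the function total: it is meant for a nonzero representation supported on
    a single value of [vsum], which it returns. *)
Definition level E := (\max_(s | rdim E s != 0) vsum s)%N.

Definition on_level E := ~ rep_is0 E /\ forall s, rdim E s != 0%N -> vsum s = level E.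

Lemma on_levelP E n : ~ rep_is0 E -> (forall s, rdim E s != 0%N -> vsum s = n) ->
  on_level E /\ level E = n.
Proof.
move=> E0 En; suff lE : level E = n by rewrite /on_level lE.
have [s s0] := rep_is0N E0; apply/eqP; rewrite eqn_leq -{2}(En s s0).
rewrite (@leq_bigmax_cond _ (fun s => rdim E s != 0%N) vsum s s0) andbT.
apply/bigmax_leqP => t t0.
by rewrite En.
Qed.

Lemma on_level_rmap E s t (st : arrow s t) : on_level E -> rmap E st = 0.
Proof.
move=> [_ El]; apply: mx_dim0; have := arrow_vsum st.
case: (eqVneq (rdim E s) 0%N) => [|/El ->]; first by left.
case: (eqVneq (rdim E t) 0%N) => [|/El ->]; first by right.
by move/n_Sn.
Qed.

Lemma on_level_isom E E' : rep_isom E E' -> on_level E -> on_level E'.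
Proof.
move=> /isom_rdim EE' [E0 El]; have [] // := @on_levelP E' (level E).
- by apply: contra_not E0 => E'0 s; rewrite EE' E'0.
- by move=> s; rewrite -EE'; exact: El.
Qed.

Lemma on_level_simple s : on_level (simple K s) /\ level (simple K s) = vsum s.
Proof.
apply: on_levelP => [/(_ s)/=|t /=]; first by rewrite eqxx.
by case: (t =P s) => [->|].
Qed.

Lemma on_level_hom_eq0 Q Q' : on_level Q -> on_level Q' -> level Q != level Q' ->
  hom_eq0 Q Q'.
Proof.
move=> [_ Ql] [_ Q'l] /eqP QQ' f s; apply: mx_dim0.
case: (eqVneq (rdim Q s) 0%N) => [|/Ql Qs]; first by left.
by case: (eqVneq (rdim Q' s) 0%N) => [|/Q'l Q's]; [right | case: QQ'; rewrite -Qs].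
Qed.

(** If the levels are neither equal nor adjacent, no arrow joins two vertices of the support of the
    extension. Its arrow maps then vanish, and any vertexwise section of [g] is a morphism. *)
Lemma on_level_ext1 Q Q' : on_level Q -> on_level Q' -> ext1_neq0 Q Q' ->
  [\/ level Q = level Q', level Q = (level Q').+1 | level Q' = (level Q).+1].
Proof.
move=> Ql Q'l [E [f [g [fg nsplit]]]]; apply: contrapT => nadj; apply: nsplit.
have dE := short_exact_rdim fg.
have E0 s t (st : arrow s t) : rmap E st = 0.
  apply: mx_dim0; apply: contrapT => /not_orP[/eqP + /eqP].
  rewrite !dE -!lt0n !addn_gt0 !lt0n => /orP s0 /orP t0; apply: nadj.
  have := arrow_vsum st.
  by case: s0 t0 => [/(Q'l.2)->|/(Ql.2)->] [/(Q'l.2)->|/(Ql.2)->] /esym e;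
    [exfalso; exact: (n_Sn _ (esym e)) | constructor 2 | constructor 3
    | exfalso; exact: (n_Sn _ (esym e))].
unshelve eexists.
  exists (fun s => pinvmx (g s)) => s t st.
  by rewrite E0 (on_level_rmap st Ql) mul0mx mulmx0.
by move=> s /=; rewrite mulVpmx//; have [] := fg s.
Qed.

(** [cokermx A] is square; its [col_base] is a projection onto the quotient by the row space of [A],
    with target of the right dimension. *)
Lemma eqmx_kermx_cokermx m n (A : 'M[K]_(m, n)) : (A == kermx (col_base (cokermx A)))%MS.
Proof.
apply/andP; split.
  rewrite sub_kermx -(mulmx_free_eq0 _ (row_base_free (cokermx A))) -mulmxA.
  by rewrite mulmx_base mulmx_coker.
by rewrite submxE -[in X in _ *m X](mulmx_base (cokermx A)) mulmxA mulmx_ker mul0mx.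
Qed.

(** The arrow maps of [E] vanish, so a basis vector at a vertex [s] of the support spans a copy of
    [simple s]. The quotient is zero or lies on the same level. *)
Lemma on_level_decompose E : on_level E ->
  exists s, vsum s = level E /\
  (rep_isom E (simple K s) \/
   exists Q (f : rhom (simple K s) E) (g : rhom E Q),
     [/\ on_level Q, level Q = level E & short_exact f g]).
Proof.
move=> El; have [s s0] := rep_is0N El.1; exists s; split; first exact: El.2.
have les t : ((t == s) <= rdim E t)%N by case: eqP => // ->; rewrite lt0n.
have @f : rhom (simple K s) E.
  exists (fun t => pid_mx (t == s)) => t u tu.
  by rewrite /= (on_level_rmap tu El) mul0mx mulmx0.
have @Q : rep K.
  by exists (fun t => \rank (cokermx (f t))) (fun t u _ => 0) => *; rewrite !mulmx0.
have @g : rhom E Q.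
  exists (fun t => col_base (cokermx (f t))) => t u tu.
  by rewrite /= (on_level_rmap tu El) mul0mx mulmx0.
have fg : short_exact f g.
  move=> t; split; last exact: eqmx_kermx_cokermx.
  - by rewrite /row_free rank_pid_mx.
  - exact: col_base_full.
have dE := short_exact_rdim fg.
have [Q0|Q0] := pselect (rep_is0 Q); [left|right].
  have dEs t : rdim E t = (t == s) by rewrite dE Q0 addn0.
  unshelve eexists.
    exists (fun t => pid_mx (rdim E t)) => t u tu.
    by rewrite /= (on_level_rmap tu El) mul0mx mulmx0.
  by exists f; split=> t /=; rewrite -?dEs pid_mxK.
exists Q, f, g; have [] // := @on_levelP Q (level E) Q0.
by move=> t t0; apply: El.2; rewrite dE addn_eq0 negb_and t0 orbT.
Qed.

End Levels.

(** * The filtration by levels *)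

Section LevelFiltration.
Variables (K : fieldType) (E : rep K).

Let top := (\max_s vsum s).+1.

(** Only the values of [vsum] that occur in the support are kept, because every quotient of the
    filtration has to be nonzero. *)
Let levels := [seq j <- iota 0 top | [exists s, (vsum s == j) && (rdim E s != 0%N)]].

(** The default [top] exceeds every [vsum]: it bounds the last slice from above and makes the
    filtration end in zero. *)
Let cut k := nth top levels k.

Let above k : pred vertex := fun s => (cut k <= vsum s)%N.

Let between k : pred vertex := fun s => (cut k <= vsum s < cut k.+1)%N.

Let above_convex k s t u : arrow s t -> arrow t u -> above k s -> above k u -> above k t.
Proof. by rewrite /above => /arrow_vsum -> _ /leqW. Qed.

Let between_convex k s t u :
  arrow s t -> arrow t u -> between k s -> between k u -> between k t.
Proof.
rewrite /between => /arrow_vsum st /arrow_vsum -> /andP[ks _] /andP[_ uk].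
by rewrite st leqW//= -st ltnW.
Qed.

Let vsum_top s : (vsum s < top)%N.
Proof. by rewrite ltnS; exact: leq_bigmax. Qed.

Let levelsP s : rdim E s != 0%N -> vsum s \in levels.
Proof.
move=> s0; rewrite mem_filter mem_iota/= vsum_top andbT.
by apply/existsP; exists s; rewrite eqxx.
Qed.

Let levels_sorted : sorted ltn levels.
Proof. exact/sorted_filter/iota_ltn_sorted/ltn_trans. Qed.

Let cutP k : (k < size levels)%N -> exists2 s, vsum s = cut k & rdim E s != 0%N.
Proof.
move=> /(mem_nth top); rewrite mem_filter => /andP[/existsP[s /andP[/eqP]]].
by exists s.
Qed.

Let cut_lt k : (k < size levels)%N -> (cut k < cut k.+1)%N.
Proof.
move=> kl; case: (ltnP k.+1 (size levels)) => kl1.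
  by move/(sortedP top): levels_sorted; exact.
by have [s <- _] := cutP kl; rewrite /cut [X in (_ < X)%N]nth_default.
Qed.

Let between_cut k s : (k < size levels)%N -> rdim E s != 0%N -> between k s -> vsum s = cut k.
Proof.
rewrite /between => kl /levelsP /(nthP top)[j jl <-] /andP[kj jk].
have cut_homo i i' : (i < i')%N -> (i' < size levels)%N -> (cut i < cut i')%N.
  move=> ii' i'l; apply: (sorted_ltn_nth ltn_trans) => //.
  exact: ltn_trans i'l.
have [jk'|kj'|-> //] := ltngtP j k.
  move: kj; rewrite leqNgt. by rewrite cut_homo.
move: jk; rewrite ltnNge; case/negP.
move: kj'; rewrite leq_eqVlt => /orP[/eqP -> //|kj'].
exact/ltnW/cut_homo.
Qed.

(** Arrows raise [vsum], so the vertices at or above a cut carry a subrepresentation. Each step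
    splits off the lowest remaining level as a quotient, hence the levels of the quotients
    increase. *)
Lemma level_filtration :
  exists (n : nat) (F Q : nat -> rep K)
         (incl : forall k, rhom (F k.+1) (F k)) (quot : forall k, rhom (F k) (Q k)),
    [/\ rep_isom (F 0%N) E, rep_is0 (F n),
        forall k, (k < n)%N -> short_exact (incl k) (quot k) /\ on_level (Q k)
      & forall k, (k.+1 < n)%N -> (level (Q k) < level (Q k.+1))%N].
Proof.
have above0 k s t : arrow s t -> above k.+1 s -> above k t -> above k.+1 t = above k s.
  rewrite /above => /arrow_vsum -> ks kt; rewrite leqW//.
  (* The inclusions form a family over all [k]; past the end of [levels] both cuts equal [top]. *)
  case: (ltnP k (size levels)) => kl; first by rewrite (leq_trans (ltnW (cut_lt kl))).
  by move: ks; rewrite /cut !nth_default// leqW// => ->.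
have between0 k s t : arrow s t -> above k s -> between k t -> above k t = between k s.
  rewrite /above /between => /arrow_vsum -> ks /andP[kt tk].
  by rewrite kt ks/= ltnW.
exists (size levels), (fun k => trunc E (@above_convex k)),
  (fun k => trunc E (@between_convex k)), (fun k => trunc_hom E _ _ (@above0 k)),
  (fun k => trunc_hom E _ _ (@between0 k)).
have lev k : (k < size levels)%N -> on_level (trunc E (@between_convex k)) /\
    level (trunc E (@between_convex k)) = cut k.
  move=> kl; apply: on_levelP => [|s].
    have [s sk s0] := cutP kl; move/(_ s) => /=; rewrite /trunc_dim /between sk.
    by rewrite leqnn cut_lt//=; apply/eqP.
  by rewrite /= /trunc_dim; case: ifP => // ks s0; exact: between_cut.
split.
- apply: trunc_isom => s /levelsP sl; rewrite /above.
  have [j jl <-] := nthP top sl.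
  have [->|j0] := posnP j; first exact: leqnn.
  apply: ltnW; apply: (sorted_ltn_nth ltn_trans) => //.
  exact: ltn_trans jl.
- move=> s /=; rewrite /trunc_dim /above /cut nth_default//.
  by rewrite leqNgt vsum_top.
- move=> k kl; split; last by have [] := lev k kl.
  apply: trunc_exact => s; rewrite /above /between.
    by have := cut_lt kl; lia.
  by lia.
- move=> k kl; have [_ ->] := lev _ (ltnW kl); have [_ ->] := lev _ kl.
  exact/cut_lt/ltnW.
Qed.
End LevelFiltration.

(** * Stability conditions whose phases increase with the level *)

Section LevelStability.
Variable R : realType.
Implicit Types E Q : rep R[i].
Variables (mass theta : nat -> R).
Hypothesis mass_gt0 : forall n, 0 < mass n.
Hypothesis theta_lt : forall n, theta n < theta n.+1.
Hypothesis theta_gap : forall n, theta n.+1 - theta n < pi.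

(** A class in the Grothendieck group is a dimension vector, so the charge is fixed by its values on
    the simples, here prescribed level by level. *)
Definition level_charge E : R[i] :=
  \sum_s (rdim E s)%:R * ((mass (vsum s))%:C * expi (theta (vsum s))).

Lemma level_charge_add E' E E'' (f : rhom E' E) (g : rhom E E'') :
  short_exact f g -> level_charge E = level_charge E' + level_charge E''.
Proof.
move=> /short_exact_rdim EE; rewrite /level_charge -big_split/=.
by apply: eq_bigr => s _; rewrite EE natrD mulrDl.
Qed.

Lemma level_charge_simple s :
  level_charge (simple _ s) = (mass (vsum s))%:C * expi (theta (vsum s)).
Proof.
rewrite /level_charge (bigD1 s)//= eqxx mul1r big1 ?addr0// => t /negPf ts.
by rewrite ts mul0r.
Qed.

Lemma level_charge_phase E : on_level E ->
  exists2 m : R, 0 < m & level_charge E = m%:C * expi (theta (level E)).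
Proof.
move=> [E0 El]; exists ((\sum_s rdim E s)%N%:R * mass (level E)).
  rewrite mulr_gt0// ltr0n lt0n sum_nat_eq0; have [s s0] := rep_is0N E0.
  by apply: contra s0 => /forallP/(_ s).
rewrite rmorphM rmorph_nat -mulrA natr_sum mulr_suml; apply: eq_bigr => s _.
by have [->|/El ->//] := eqVneq (rdim E s) 0%N; rewrite !mul0r.
Qed.

Lemma theta_mono : {mono theta : m n / (m < n)%N >-> m < n}.
Proof.
have homo : {homo theta : m n / (m < n)%N >-> m < n}.
  by apply: (@homo_ltn _ theta (fun x y => x < y)) => // ? ? ?; exact: lt_trans.
move=> m n; case: (ltngtP m n) => [/homo->|/homo/ltW|->]; rewrite ?ltxx//.
by rewrite leNgt => /negPf.
Qed.

(** Extensions link only equal or adjacent levels, so [theta_gap] gives the Ext condition;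
    monotonicity of [theta] gives the Hom condition and orders the filtration. *)
Definition level_stability : stability R.
Proof.
apply: (@Stability R level_charge level_charge_add (@on_level _)
  (fun E => theta (level E))).
- by move=> Q [].
- by move=> Q Q'; exact: on_level_isom.
- exact: level_charge_phase.
- move=> Q Q' Ql Q'l /(on_level_ext1 Ql Q'l)[->|->|->].
  + by rewrite subrr normr0 pi_gt0.
  + by rewrite gtr0_norm ?subr_gt0.
  + by rewrite distrC gtr0_norm ?subr_gt0.
- move=> Q Q' Ql Q'l; rewrite theta_mono => QQ'.
  by apply: on_level_hom_eq0 => //; rewrite gtn_eqF.
- move=> E _; have [n [F [Q [incl [quot [F0 Fn FQ lev]]]]]] := level_filtration E.
  by exists n, F, Q, incl, quot; split=> // k /lev; rewrite theta_mono.
Defined.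

(** Otherwise [on_level_decompose] exhibits [E] as an extension of two semistable objects of its own
    phase. *)
Lemma level_stable_simple E : stable level_stability E ->
  exists s, rep_isom E (simple _ s).
Proof.
move=> [/= El nE]; have [s [sl [|[Q [f [g [Ql QE fg]]]]]]] := on_level_decompose El.
  by exists s.
exfalso; apply: nE; have [? ls] := on_level_simple R[i] s.
by exists (simple _ s), Q, f, g; split=> //=; rewrite ?ls ?sl ?QE.
Qed.

End LevelStability.

(** * Equivalences and the heart *)

Section Categories.

Lemma isom_refl (C : category) (X : C) : isom X X.
Proof. by exists (idm X), (idm X); split; exact: comp1m. Qed.

Lemma isom_sym (C : category) (X Y : C) : isom X Y -> isom Y X.
Proof. by move=> [f [g [fg gf]]]; exists g, f. Qed.

Lemma isom_trans (C : category) (Y X Z : C) : isom X Y -> isom Y Z -> isom X Z.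
Proof.
have compK (A B D : C) (f : Defs.hom A B) (g : Defs.hom B A) (f' : Defs.hom B D) (g' : Defs.hom D B) :
    heq (Defs.comp f g) (idm A) -> heq (Defs.comp f' g') (idm B) ->
    heq (Defs.comp (Defs.comp f f') (Defs.comp g' g)) (idm A).
  move=> fg f'g'; apply: heq_trans fg; apply: heq_trans (compmA _ _ _) _.
  apply: comp_heq (heq_refl _).
  apply: heq_trans (heq_sym (compmA _ _ _)) _; apply: heq_trans (compm1 f).
  exact: comp_heq (heq_refl _) _.
move=> [f [g [fg gf]]] [f' [g' [fg' gf']]].
by exists (Defs.comp f f'), (Defs.comp g' g); split; exact: compK.
Qed.

Lemma functor_isom (C D : category) (F : functor C D) (X Y : C) :
  isom X Y -> isom (F X) (F Y).
Proof.
move=> [f [g [fg gf]]]; exists (Defs.fmap F f), (Defs.fmap F g).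
by split; apply: heq_trans (heq_sym (Defs.fmap_comp F _ _)) _;
  apply: heq_trans (fmap1 F _); exact: fmap_heq.
Qed.

Lemma nat_isom_isom (C D : category) (F G : functor C D) (X : C) :
  nat_isom F G -> isom (F X) (G X).
Proof. by move=> [a [b [ab _]]]; exists (a X), (b X). Qed.

Lemma equivalence_reflect_isom (C D : category) (F : functor C D) (X Y : C) :
  is_equivalence F -> isom (F X) (F Y) -> isom X Y.
Proof.
move=> [faith full _] [f [g [fg gf]]].
have [f' f'f] := full _ _ f; have [g' g'g] := full _ _ g.
exists f', g'; split; apply: faith; apply: heq_trans (Defs.fmap_comp F _ _) _;
  apply: heq_trans (heq_sym (fmap1 F _)).
- exact: heq_trans (comp_heq f'f g'g) fg.
- exact: heq_trans (comp_heq g'g f'f) gf.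
Qed.

Lemma functor_powD (C : category) (F : functor C C) m n (X : C) :
  functor_pow F (m + n) X = functor_pow F m (functor_pow F n X).
Proof. by elim: m => // m IH; rewrite addSn /functor_pow !iterS /= -/(functor_pow F _) IH. Qed.

Lemma functor_pow_reflect_isom (C : category) (F : functor C C) n (X Y : C) :
  is_equivalence F -> isom (functor_pow F n X) (functor_pow F n Y) -> isom X Y.
Proof. by move=> Fe; elim: n => //= n IH /(equivalence_reflect_isom Fe). Qed.

Lemma functor_pow_surj (C : category) (F : functor C C) n (Y : C) :
  is_equivalence F -> exists X, isom (functor_pow F n X) Y.
Proof.
move=> [faith full surj]; elim: n Y => [|n IH] Y; first by exists Y; exact: isom_refl.
have [Z ZY] := surj Y; have [X XZ] := IH Z; exists X.
exact: isom_trans (functor_isom F XZ) ZY.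
Qed.

Lemma functor_pow_commute (C D : category) (F : functor C D) (S : functor C C)
    (T : functor D D) n (X : C) :
  nat_isom (comp_functor F S) (comp_functor T F) ->
  isom (F (functor_pow S n X)) (functor_pow T n (F X)).
Proof.
move=> FS; elim: n => [|n IH] /=; first exact: isom_refl.
apply: isom_trans (functor_isom T IH).
exact: (nat_isom_isom (functor_pow S n X) FS).
Qed.

Lemma functor_powM (C : category) (F G : functor C C) m n q (X : C) :
  nat_isom (functor_pow F m) (functor_pow G n) ->
  isom (functor_pow F (q * m) X) (functor_pow G (q * n) X).
Proof.
move=> FG; elim: q => [|q IH]; first exact: isom_refl.
rewrite !mulSn !functor_powD; apply: isom_trans (nat_isom_isom _ FG).
exact: functor_isom.
Qed.

End Categories.

(** * The standard heart inside the derived category *)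

Section Heart.
Variable K : fieldType.

(** Localization keeps the objects, so [heart E] is a complex by conversion. *)
Definition heart_cplx (E : rep K) : cplx K := heart E.

(** The return clause lets the types of source and target follow the test [n == 0]. *)
Definition heart_map (E E' : rep K) (f : rhom E E') :
  chain_map (heart_cplx E) (heart_cplx E').
Proof.
exists (fun n : int => match n == 0 as b return
    rhom (if b then E else rep_zero K) (if b then E' else rep_zero K) with
  | true => f | false => rhom_zero _ _ end) => m n s /=.
by rewrite mul0mx mulmx0.
Defined.

(** The isomorphism already exists between complexes and passes to the localization through
    [zz_hom], without any formal inverse. *)
Lemma heart_isom (E E' : rep K) : rep_isom E E' -> isom (heart E) (heart E').
Proof.
have mapK (X Y : rep K) (f : rhom X Y) (g : rhom Y X) :
    (forall s, f s *m g s = 1%:M) ->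
    @heq (Db K) _ _ (@Defs.comp (Db K) _ _ _
        (zz_hom _ (heart_map f : @Defs.hom (cplx_cat K) _ _))
        (zz_hom _ (heart_map g : @Defs.hom (cplx_cat K) _ _))) (idm (heart X)).
  move=> fg; apply: zz_trans (zz_sym (zz_hom_comp _ _ _)) _.
  apply: zz_hom_heq => n s /=; case: (n == 0) => /=; first exact: fg.
  by rewrite [LHS]flatmx0 [RHS]flatmx0.
move=> [f [g [fg gf]]].
by exists (zz_hom _ (heart_map f : @Defs.hom (cplx_cat K) _ _)),
  (zz_hom _ (heart_map g : @Defs.hom (cplx_cat K) _ _)); split; exact: mapK.
Qed.
End Heart.

(* With n + i = 5 q, the relation tau^5 = [2] identifies tau^i O_X with E shifted by 2 q. *)
Lemma simple_beilinson (K : fieldType) (DG DX : shift_category)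
  (Phi : functor (Db K) DG) (forget : functor DG DX)
  (hforget : nat_isom (comp_functor forget (shift_functor DG))
                      (comp_functor (shift_functor DX) forget))
  (OX : DX) (tau : functor DX DX)
  (htau5 : nat_isom (functor_pow tau 5) (functor_pow (shift_functor DX) 2))
  (beilinson : 'I_5 -> DX)
  (hbeilinson : forall i : 'I_5, isom_to_shift (functor_pow tau i OX) (beilinson i))
  (n : nat) (E : Db K) :
  isom (functor_pow tau n (forget (Phi E))) OX ->
  exists (B : DG) (i : 'I_5), isom (forget B) (beilinson i) /\ isom_to_shift (Phi E) B.
Proof.
move=> En; have [i [q niq]] : exists (i : 'I_5) q, (i + n = q * 5)%N.
  (* The residue of [-n] modulo 5; the outer reduction handles [n] divisible by 5. *)
  have i5 : ((5 - n %% 5) %% 5 < 5)%N by rewrite ltn_pmod.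
  by exists (Ordinal i5), (((5 - n %% 5) %% 5 + n) %/ 5)%N => /=; lia.
have [a [b ab]] := hbeilinson i.
(* [B] is [Phi E] shifted by [a + 2 q - b]; surjectivity of the shift up to isomorphism replaces a
   negative shift. *)
have [B BE] := functor_pow_surj b (functor_pow (shift_functor DG) (a + q * 2) (Phi E))
  (shift_equiv DG).
exists B, i; split; last by exists (a + q * 2)%N, b; exact: isom_sym.
apply: (functor_pow_reflect_isom (n := b) (shift_equiv DX)); apply: isom_trans ab.
apply: isom_trans (isom_sym (functor_pow_commute b B hforget)) _.
apply: isom_trans (functor_isom forget BE) _.
apply: isom_trans (functor_pow_commute _ _ hforget) _.
rewrite functor_powD; apply: functor_isom.
apply: isom_trans (isom_sym (functor_powM q _ htau5)) _.
rewrite -niq functor_powD; exact: functor_isom.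
Qed.

(** * The Gamma integral *)

Section Gamma.
Variable R : realType.
Implicit Types a t : R.

Local Notation mu := (@lebesgue_measure R).
Local Notation Rpos := (`]0, +oo[%classic : set R).

(** The extended real behind [Gamma]: divergence shows here as [+oo], which [fine] turns into 0. *)
Definition gamma_integral a : \bar R :=
  (\int[mu]_(t in Rpos) (t `^ (a - 1) * expR (- t))%:E)%E.

Lemma GammaE a : Gamma a = fine (gamma_integral a).
Proof. by []. Qed.

Lemma measurable_gamma a (A : set R) :
  measurable_fun A (EFin \o (fun t => t `^ (a - 1) * expR (- t))).
Proof.
apply/measurable_EFinP; apply: measurable_funTS; apply: measurable_funM.
  exact: measurable_powR.
exact: measurableT_comp.
Qed.

Lemma gamma_integrand_ge0 a t : (0 <= (t `^ (a - 1) * expR (- t))%:E)%E.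
Proof. by rewrite lee_fin mulr_ge0// ?powR_ge0// expR_ge0. Qed.

(** The integrand is the density of the exponential law of rate 1. *)
Lemma gamma_integral1 : gamma_integral 1 = 1%E.
Proof.
rewrite /gamma_integral.
under eq_integral do rewrite subrr powRr0 mul1r.
rewrite integral_itv_obnd_cbnd; last exact/measurable_EFinP/measurableT_comp.
rewrite -(integral_exponential_pdf (@ltr01 R)) integral_mkcond.
apply: eq_integral => t _; rewrite /exponential_pdf !patchE.
by case: ifP; rewrite ?mul1r ?mulN1r.
Qed.

(** The interval from 1 to 2 has length 1, and [expR (- t)] is at least [expR (- 2)] on it. *)
Lemma gamma_integral_ge a (c : R) : 0 <= c -> (forall t, 1 <= t <= 2 -> c <= t `^ (a - 1)) ->
  ((c * expR (- 2))%:E <= gamma_integral a)%E.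
Proof.
move=> c0 ct.
pose I12 : set R := [set` `[1, 2]]; have m12 : measurable I12 by exact: measurable_itv.
apply: (@le_trans _ _ (\int[mu]_(t in I12) (t `^ (a - 1) * expR (- t))%:E)%E).
  apply: (@le_trans _ _ (\int[mu]_(t in I12) cst (c * expR (- 2))%:E t)%E).
    rewrite integral_cst//= lebesgue_measure_itv/= lte_fin ltr1n -EFinD.
    by rewrite -EFinM (_ : 2 - 1 = 1) ?mulr1//; lra.
  apply: ge0_le_integral => //.
  - by move=> x _; rewrite lee_fin mulr_ge0// expR_ge0.
  - exact: measurable_gamma.
  - move=> t; rewrite /I12/= in_itv/= => /andP[t1 t2]; rewrite lee_fin ler_pM ?expR_ge0//.
      by rewrite ct// t1 t2.
    by rewrite ler_expR lerN2.
apply: ge0_subset_integral => //.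
- exact: measurable_gamma.
- by move=> x _; exact: gamma_integrand_ge0.
- by move=> t; rewrite /I12/= !in_itv/= andbT => /andP[t1 _]; exact: lt_le_trans t1.
Qed.

(** The integrand may be singular at 0, so the fundamental theorem of calculus is applied on the
    intervals [A n] and monotone convergence passes to their union. *)
Lemma integral_powR01 a : 0 < a -> (\int[mu]_(t in `]0%R, 1%R]) (t `^ (a - 1))%:E <= (a^-1)%:E)%E.
Proof.
move=> a0.
pose A n : set R := [set` `[n.+2%:R^-1, 1]].
have n01 n : 0 < n.+2%:R^-1 :> R by [].
have -> : `]0, 1]%classic = \bigcup_n A n.
  apply/seteqP; split=> [t|t [n _]]; rewrite /A/= !in_itv/=; last first.
    by move=> /andP[nt ->]; rewrite (lt_le_trans (n01 n) nt).
  move=> /andP[t0 t1]; exists (Num.trunc t^-1) => //=; rewrite in_itv/= t1 andbT.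
  rewrite invf_ple ?posrE//; apply/ltW/(lt_le_trans (truncnS_gt _)).
  by rewrite ler_nat.
have F0 (x : R) : 0 < x -> is_derive x 1 (fun t : R => a^-1 * t `^ a) (x `^ (a - 1)).
  move=> x0; have := is_derive1_powR a x0 => d.
  by apply: is_derive_eq; rewrite /GRing.scale/= mulrA mulVf ?mul1r// gt_eqF.
have D0 (x : R) : 0 < x -> {for x, continuous (fun t : R => t `^ (a - 1))}.
  move=> x0; apply/differentiable_continuous/derivable1_diffP.
  by apply: derivable_powR; rewrite in_itv/= x0.
have C0 (x : R) : 0 < x -> {for x, continuous (fun t : R => a^-1 * t `^ a)}.
  move=> x0; apply/differentiable_continuous/derivable1_diffP.
  by have [] := F0 x x0.
have cvgI : ((\int[mu]_(t in A n) (t `^ (a - 1))%:E) @[n --> \oo] -->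
    \int[mu]_(t in \bigcup_n A n) (t `^ (a - 1))%:E)%E.
  apply: ge0_nondecreasing_set_cvg_integral => //.
  - apply/nondecreasing_seqP => n; apply/subsetPset => t; rewrite /A/= !in_itv/=.
    move=> /andP[nt ->]; rewrite andbT (le_trans _ nt)// lef_pV2 ?posrE// ler_nat.
    exact: leqnSn.
  - by move=> n; exact: measurable_itv.
  - by move=> n; apply/measurable_EFinP; apply: measurable_funTS; exact: (@measurable_powR R).
  - by move=> n t _; rewrite lee_fin powR_ge0.
rewrite -(cvg_lim _ cvgI)//; apply: lime_le; first by apply/cvg_ex; eexists; exact: cvgI.
apply: nearW => n.
have n1 : n.+2%:R^-1 < 1 :> R by rewrite invf_lt1 ?posrE// ltr1n.
rewrite (@continuous_FTC2 _ _ (fun t : R => a^-1 * t `^ a))//.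
- rewrite powR1 mulr1 -EFinB lee_fin lerBlDr lerDl.
  by rewrite mulr_ge0 ?powR_ge0// invr_ge0 ltW.
- apply: continuous_in_subspaceT => x; rewrite inE/= in_itv/= => /andP[nx _].
  exact/D0/(lt_le_trans (n01 n)).
- split.
  + by move=> x; rewrite in_itv/= => /andP[nx _]; have [] := F0 x (lt_trans (n01 n) nx).
  + by apply/cvg_at_right_filter; exact: C0.
  + by apply/cvg_at_left_filter; exact: C0.
- move=> x; rewrite in_itv/= => /andP[nx _]; rewrite derive1E.
  by have [_ ->] := F0 x (lt_trans (n01 n) nx).
Qed.

(** Up to 1 the integrand is dominated by [t ^ (a - 1)]; beyond 1, as [a <= 1], by [expR (- t)]. *)
Lemma gamma_integral_lty a : 0 < a <= 1 -> (gamma_integral a < +oo)%E.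
Proof.
move=> /andP[a0 a1]; rewrite /gamma_integral.
have -> : `]0, +oo[%classic = `]0, 1] `|` `]1, +oo[ :> set R.
  apply/seteqP; split=> t /=; rewrite !in_itv/= !andbT.
    by move=> t0; rewrite t0; case: (leP t 1); [left|right].
  by case=> [/andP[]//|]; exact: lt_trans.
rewrite ge0_integral_setU//=; first last.
- apply/disj_setPS => t /=; rewrite !in_itv/= !andbT => -[/andP[_ t1] /lt_geF].
  by rewrite t1.
- by move=> t _; exact: gamma_integrand_ge0.
- exact: measurable_gamma.
rewrite lte_add_pinfty//.
  apply: le_lt_trans (ltry a^-1); apply: le_trans (integral_powR01 a0).
  apply: ge0_le_integral => //.
  - by move=> t _; exact: gamma_integrand_ge0.
  - exact: measurable_gamma.
  - by apply/measurable_EFinP; apply: measurable_funTS; exact: (@measurable_powR R).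
  - move=> t /=; rewrite in_itv/= => /andP[t0 _]; rewrite lee_fin ler_piMr ?powR_ge0//.
    by rewrite -expR0 ler_expR oppr_le0 ltW.
apply: le_lt_trans (ltry 1); rewrite -gamma_integral1.
apply: (@le_trans _ _ (\int[mu]_(t in `]1%R, +oo[) (t `^ (1 - 1) * expR (- t))%:E)%E).
  apply: ge0_le_integral => //.
  - by move=> t _; exact: gamma_integrand_ge0.
  - exact: measurable_gamma.
  - exact: measurable_gamma.
  - move=> t /=; rewrite in_itv/= andbT => t1; rewrite lee_fin ler_wpM2r ?expR_ge0//.
    by rewrite ler_powR ?(ltW t1)// lerD2r.
apply: ge0_subset_integral => //.
- exact: measurable_gamma.
- by move=> t _; exact: gamma_integrand_ge0.
- by move=> t /=; rewrite !in_itv/= !andbT; exact: lt_trans.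
Qed.

Lemma Gamma_ge0 a : 0 <= Gamma a.
Proof.
by rewrite fine_ge0// integral_ge0// => t _; exact: gamma_integrand_ge0.
Qed.

(** Serves at 1/5 and 1, the arguments in the leading coefficient [omega_coef 1 0]. On the interval
    from 1 to 2 the power [t ^ (a - 1)] is smallest at 2. *)
Lemma Gamma_gt0 a : 0 < a <= 1 -> 0 < Gamma a.
Proof.
move=> a01; have afin := gamma_integral_lty a01; apply: fine_gt0; rewrite afin andbT.
apply: lt_le_trans (@gamma_integral_ge a (2 `^ (a - 1)) _ _).
- by rewrite lte_fin mulr_gt0 ?powR_gt0 ?expR_gt0.
- exact: powR_ge0.
- move=> t /andP[t1 t2]; have /andP[a0 a1] := a01.
  rewrite -[a - 1]opprB !powRN lef_pV2 ?posrE ?powR_gt0//; last exact: lt_le_trans t1.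
  by rewrite ge0_ler_powR ?nnegrE ?subr_ge0// (le_trans _ t1).
Qed.

(* Jensen's inequality for the probability measure e^(-t) dt on ]0, +oo[ and the
   function y^5 at y = t^(a - 1), whose tangent line at y = l bounds it below. *)
Lemma Gamma_pow5_le a : 1 <= a -> (gamma_integral (5 * a) < +oo)%E ->
  Gamma a ^+ 5 <= 1 + Gamma (5 * a).
Proof.
move=> a1 G5; set l := Gamma a; have l0 : 0 <= l := Gamma_ge0 a.
have G0 b : (0 <= gamma_integral b)%E.
  by apply: integral_ge0 => t _; exact: gamma_integrand_ge0.
(* A divergent integral makes [l] the default value 0. *)
have [Ga|Ga] := eqVneq (gamma_integral a) +oo%E.
  have -> : l = 0 by rewrite /l GammaE Ga.
  by rewrite expr0n/= addr_ge0 ?ler01 ?Gamma_ge0.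
have Efin b : (gamma_integral b < +oo)%E -> gamma_integral b = (Gamma b)%:E.
  by move=> ?; rewrite GammaE fineK// ge0_fin_numE.
(* The tangent inequality [5 l^4 y <= y^5 + 4 l^5], weakened by [y^5 <= 1 + t^(5a - 1)] and
   integrated. *)
suff : ((5 * l ^+ 4)%:E * gamma_integral a <=
    (1 + 4 * l ^+ 5)%:E * gamma_integral 1 + gamma_integral (5 * a))%E.
  have Gal : (gamma_integral a < +oo)%E by rewrite ltey.
  rewrite gamma_integral1 mule1 (Efin _ G5) (Efin _ Gal) -EFinM -EFinD lee_fin -/l.
  by rewrite -mulrA -exprSr; lra.
have l50 : 0 <= 1 + 4 * l ^+ 5 by rewrite addr_ge0// mulr_ge0 ?exprn_ge0.
have l40 : 0 <= 5 * l ^+ 4 by rewrite mulr_ge0 ?exprn_ge0.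
have ge0 b (t : R) : `]0, +oo[%classic t -> (0 <= (t `^ (b - 1) * expR (- t))%:E)%E.
  by move=> _; exact: gamma_integrand_ge0.
have mg b := @measurable_gamma b `]0, +oo[%classic.
rewrite /gamma_integral -!ge0_integralZl ?lee_fin//;
  try (exact: ge0 || exact: mg).
have mgZ (c b : R) : measurable_fun Rpos
    (fun t : R => (c%:E * (t `^ (b - 1) * expR (- t))%:E)%E).
  exact: (measurable_funeM _ (mg b)).
have ge0Z (c b : R) (t : R) : 0 <= c -> Rpos t ->
    (0 <= c%:E * (t `^ (b - 1) * expR (- t))%:E)%E.
  by move=> c0 t0; apply: mule_ge0; [rewrite lee_fin | exact: ge0].
rewrite -ge0_integralD//; try (exact: mg || exact: mgZ || exact: ge0 ||
  by move=> t; exact: ge0Z).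
apply: ge0_le_integral => //.
- by move=> t; exact: ge0Z.
- exact: mgZ.
- by apply: emeasurable_funD; [exact: mgZ | exact: mg].
move=> t /=; rewrite in_itv/= andbT => t0.
rewrite -!EFinM -EFinD lee_fin !mulrA -mulrDl ler_wpM2r ?expR_ge0//.
rewrite subrr powRr0 mulr1; set y := t `^ (a - 1).
have y0 : 0 <= y := powR_ge0 _ _.
(* Here [y^5 = t^(5a - 5)], at most 1 for [t <= 1] and at most [t^(5a - 1)] for larger [t]. *)
have y5 : y ^+ 5 <= 1 + t `^ (5 * a - 1).
  rewrite -powR_mulrn// /y -powRrM; case: (leP t 1) => t1.
    rewrite ler_wpDr ?powR_ge0// -[leRHS](powRr0 t).
    by rewrite ger_powR ?t0//; lra.
  by rewrite ler_wpDl// ler_powR ?(ltW t1)//; lra.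
have : 0 <= (y - l) ^+ 2 * (y ^+ 3 + 2 * l * y ^+ 2 + 3 * l ^+ 2 * y + 4 * l ^+ 3).
  by rewrite mulr_ge0 ?sqr_ge0// !addr_ge0// !mulr_ge0// exprn_ge0.
rewrite [leRHS](_ : _ = y ^+ 5 - 5 * l ^+ 4 * y + 4 * l ^+ 5); last by ring.
by lra.
Qed.

(* If the integral defining Gamma (5 * a) diverged, the quotient would be x / 0 = 0,
   so its convergence need not be discussed. *)
Lemma Gamma_ratio_le a : 1 <= a ->
  0 <= Gamma a ^+ 5 / Gamma (5 * a) <= 1 + expR 2.
Proof.
move=> a1; rewrite divr_ge0 ?exprn_ge0 ?Gamma_ge0//=.
have e2 : 0 <= 1 + expR 2 :> R by rewrite addr_ge0 ?expR_ge0.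
have [G5|] := ltP (gamma_integral (5 * a)) +oo%E; last first.
  by rewrite leye_eq => /eqP G5; rewrite (GammaE (5 * a)) G5 invr0 mulr0.
(* Absorbs the additive 1 of [Gamma_pow5_le] into [expR 2] times [Gamma (5 * a)]. *)
have G5ge : expR (- 2) <= Gamma (5 * a).
  rewrite GammaE -lee_fin fineK ?ge0_fin_numE ?integral_ge0//; last first.
    by move=> t _; exact: gamma_integrand_ge0.
  rewrite -[expR _]mul1r; apply: gamma_integral_ge => // t /andP[t1 _].
  by rewrite -[leLHS](powRr0 t) ler_powR//; lra.
rewrite ler_pdivrMr ?(lt_le_trans (expR_gt0 _) G5ge)//.
apply: le_trans (Gamma_pow5_le a1 G5) _.
have : 1 <= expR 2 * Gamma (5 * a).
  by rewrite -[leLHS](@expRxMexpNx_1 R 2) ler_wpM2l ?expR_ge0.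
by rewrite mulrDl mul1r; move: (Gamma _) => g; lra.
Qed.

End Gamma.

(** * The central charge near the Gepner point *)

Section ComplexSeries.
Variable R : realType.
Implicit Types (x y B : R) (z w : R[i]).

Lemma normc_real x : `|x%:C| = `|x|%:C.
Proof. by rewrite normc_def/= expr0n/= addr0 sqrtr_sqr. Qed.

Lemma norm_Re_le z B : `|z| <= B%:C -> `|complex.Re z| <= B.
Proof. by rewrite -lecR; apply: le_trans; exact: normc_ge_Re. Qed.

Lemma norm_Im_le z B : `|z| <= B%:C -> `|complex.Im z| <= B.
Proof.
rewrite normc_def lecR; apply: le_trans; rewrite -sqrtr_sqr ler_wsqrtr//.
by rewrite lerDr sqr_ge0.
Qed.

Lemma norm_le_ReIm z : `|z| <= (`|complex.Re z| + `|complex.Im z|)%:C.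
Proof.
rewrite normc_def lecR; case: z => a b /=.
have -> : `|a| + `|b| = Num.sqrt ((`|a| + `|b|) ^+ 2).
  by rewrite sqrtr_sqr [RHS]ger0_norm// addr_ge0.
rewrite ler_wsqrtr// -(real_normK (num_real a)) -(real_normK (num_real b)) sqrrD lerD2r.
by rewrite lerDl mulrn_wge0// mulr_ge0.
Qed.

Lemma cvg_ReIm (f : nat -> R[i]) z :
  (complex.Re (f n) @[n --> \oo] --> complex.Re z) ->
  (complex.Im (f n) @[n --> \oo] --> complex.Im z) ->
  (f n : R[i]^o) @[n --> \oo] --> (z : R[i]^o).
Proof.
(* Positivity in the order of [R[i]] forces the radius to be real. *)
move=> fRe fIm; apply/cvgrPdist_lt => -[e e']; rewrite ltcE/= => /andP[/eqP -> e0].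
have e20 : 0 < e / 2 by rewrite divr_gt0.
move/cvgrPdist_lt: fRe => /(_ _ e20) fRe; move/cvgrPdist_lt: fIm => /(_ _ e20) fIm.
near=> n; apply: le_lt_trans (norm_le_ReIm _) _.
rewrite (_ : e +i* 0 = e%:C)// ltcR [ltRHS]splitr.
rewrite !raddfB; apply: ltrD; near: n; [exact: fRe | exact: fIm].
Unshelve. all: by end_near. Qed.

Lemma cvg_series_half (w : nat -> R) B : (forall n, `|w n| <= B * 2^-1 ^+ n) ->
  cvgn (series w) /\ `|limn (series w)| <= 2 * B.
Proof.
move=> wB.
have half1 : `|2^-1| < 1 :> R by rewrite ger0_norm ?invr_ge0// invf_lt1// ltr1n.
have B0 : 0 <= B by have := wB 0%N; rewrite expr0 mulr1; apply: le_trans.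
have gB : series (geometric B 2^-1) n @[n --> \oo] --> 2 * B.
  rewrite (_ : 2 * B = B / (1 - 2^-1)); first exact: cvg_geometric_series.
  by field; rewrite ?pnatr_eq0//; lra.
have wn : cvgn [normed series w].
  apply: (@series_le_cvg _ _ (geometric B 2^-1)) => // [n|n|].
  - exact: normr_ge0.
  - by rewrite geometric_ge0// invr_ge0.
  - exact: is_cvg_geometric_series.
split; first exact: normed_cvg.
apply: le_trans (lim_series_norm wn) _; rewrite -(cvg_lim _ gB)//.
apply: ler_lim => //; first by apply/cvg_ex; exists (2 * B).
by apply: nearW => n; apply: ler_sum => i _; exact: wB.
Qed.

Lemma cvg_complex_series_half (w : nat -> R[i]) B :
  (forall n, `|w n| <= (B * 2^-1 ^+ n)%:C) ->
  exists2 z, (\sum_(0 <= i < n) w i : R[i]^o) @[n --> \oo] --> (z : R[i]^o)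
    & `|z| <= (4 * B)%:C.
Proof.
move=> wB.
have [cRe lRe] := @cvg_series_half (fun n => complex.Re (w n)) B (fun n => norm_Re_le (wB n)).
have [cIm lIm] := @cvg_series_half (fun n => complex.Im (w n)) B (fun n => norm_Im_le (wB n)).
exists (limn (series (fun n => complex.Re (w n))) +i* limn (series (fun n => complex.Im (w n)))).
  apply: cvg_ReIm => /=.
    rewrite (_ : (fun n => _) = series (fun n => complex.Re (w n)))//.
    by apply/funext => n; rewrite raddf_sum.
  rewrite (_ : (fun n => _) = series (fun n => complex.Im (w n)))//.
  by apply/funext => n; rewrite raddf_sum.
apply: le_trans (norm_le_ReIm _) _; rewrite lecR/= (_ : 4 * B = 2 * B + 2 * B); last by ring.
exact: lerD.
Qed.

Lemma normcE_real z : exists2 r : R, 0 <= r & `|z| = r%:C.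
Proof.
exists (Num.sqrt (complex.Re z ^+ 2 + complex.Im z ^+ 2)); first exact: sqrtr_ge0.
exact: normc_def.
Qed.

(** Beyond the first term the exponent is at least [n + 2]: two factors give [|u| ^+ 2], [n] factors
    a geometric series of ratio 1/2, and the rest are at most 1. *)
Lemma power_series_head (a : nat -> R) (M : R) (k : nat) (u : R[i]) :
  (forall n, `|a n.+1| <= M) -> `|u| <= (2^-1)%:C ->
  `|lim ((fun n => \sum_(0 <= j < n) (a j)%:C * u ^+ (5 * j + k) : R[i]^o) @ \oo)
    - (a 0%N)%:C * u ^+ k| <= (4 * M)%:C * `|u| ^+ 2.
Proof.
move=> aM; have [r r0 ur] := normcE_real u; rewrite ur lecR => r12.
have M0 : 0 <= M := le_trans (normr_ge0 _) (aM 0%N).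
pose w n := (a n.+1)%:C * u ^+ (5 * n.+1 + k).
have [|z cz zB] := @cvg_complex_series_half w (M * r ^+ 2).
  move=> n; rewrite /w normrM normc_real normrX ur -rmorphXn -rmorphM lecR -mulrA.
  apply: ler_pM => //; first exact: exprn_ge0.
  rewrite (_ : 5 * n.+1 + k = 2 + (n + (4 * n + k + 3)))%N; last by lia.
  have rn m : 0 <= r ^+ m := exprn_ge0 m r0.
  have rn1 m : r ^+ m <= 1.
    by rewrite exprn_ile1// (le_trans r12)// invf_le1// ler1n.
  move: (4 * n + k + 3)%N => m; rewrite 2!exprD ler_wpM2l// -[leRHS]mulr1.
  apply: ler_pM => //.
  by rewrite lerXn2r ?nnegrE ?invr_ge0.
pose f n : R[i]^o := \sum_(0 <= j < n) (a j)%:C * u ^+ (5 * j + k).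
have fS n : f n.+1 = (a 0%N)%:C * u ^+ k + \sum_(0 <= i < n) w i.
  by rewrite /f big_nat_recl.
have cf : f n @[n --> \oo] --> ((a 0%N)%:C * u ^+ k + z : R[i]^o).
  rewrite -(cvg_shiftS f); under eq_fun do rewrite fS.
  by apply: (@cvgD _ R[i]^o _ _ _ (fun=> _)); [exact: cvg_cst | exact: cz].
rewrite -/f (cvg_lim _ cf); last exact: norm_hausdorff.
by rewrite addrC addKr -rmorphXn -rmorphM -mulrA.
Qed.
End ComplexSeries.

(** * Charges of the simples and their leading term *)

Section QuinticCharge.
Variable R : realType.
Implicit Types (t : R) (z u : R[i]) (k n : nat).

Local Notation xi := (xi R).

Lemma expi0 : expi (0 : R) = 1.
Proof. by rewrite /expi cos0 sin0. Qed.

Lemma expiD t t' : expi (t + t') = expi t * expi t'.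
Proof. by rewrite /expi cosD sinD; simpc; congr (_ +i* _); ring. Qed.

Lemma expiX t n : expi t ^+ n = expi (n%:R * t).
Proof.
elim: n => [|n IH]; first by rewrite mul0r expi0.
by rewrite exprS IH -expiD -natr1 mulrDl mul1r addrC.
Qed.

Lemma norm_expi t : `|expi t| = 1.
Proof. by rewrite normc_def/= cos2Dsin2 sqrtr1. Qed.

Lemma xi5 : xi ^+ 5 = 1.
Proof.
rewrite expiX mulrC divfK// /expi mulr_natl.
by rewrite -[pi *+ 2]add0r cosD2pi sinD2pi cos0 sin0.
Qed.

Lemma xi_neq1 : xi != 1.
Proof.
rewrite /Defs.xi /expi; apply/eqP => -[_ s0].
suff : 0 < sin (2 * pi / 5) :> R by rewrite s0 ltxx.
by apply: sin_gt0_pi; have := pi_gt0 R; move=> ?; apply/andP; split; lra.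
Qed.

(** The part of the [k]-th summand of [omega_inf j] that is independent of [j]; the index [j] enters
    only as an exponent of the fifth root of unity [xi ^+ k]. *)
Definition omega_weight k u := (1 - xi ^+ k) ^+ 4 * omega_tilde k u.

Lemma omega_infE j u :
  omega_inf j u = \sum_(1 <= k < 6) omega_weight k u * (xi ^+ k) ^+ j.
Proof.
by apply: eq_bigr => k _; rewrite /omega_weight exprM mulrAC.
Qed.

Lemma omega_inf_period j u : omega_inf (j + 5) u = omega_inf j u.
Proof.
rewrite !omega_infE; apply: eq_bigr => k _; rewrite -!exprM mulnDr exprD.
by rewrite (mulnC k 5) (exprM xi 5) xi5 expr1n mulr1.
Qed.

(* For a fifth root of unity z, the factor (1 - z)^4 kills 1 + z + z^2 + z^3 + z^4. *)
Lemma omega_inf_sum j u : omega_inf j u + omega_inf j.+1 u + omega_inf j.+2 u +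
  omega_inf j.+3 u + omega_inf j.+4 u = 0.
Proof.
rewrite !omega_infE -!big_split/= big1// => k _.
have : (xi ^+ k) ^+ 5 = 1 by rewrite -exprM mulnC exprM xi5 expr1n.
rewrite /omega_weight; move: (xi ^+ k) => z z5.
transitivity ((1 - z) ^+ 3 * omega_tilde k u * z ^+ j * (1 - z ^+ 5)).
  by rewrite !(exprS z); ring.
by rewrite z5 subrr mulr0.
Qed.

(** [matM] raises all indices of the period vector by 1: its third row is the relation
    [omega_inf_sum], its fourth the period 5. The last row of [matN] then takes the difference of
    the first two entries. *)
Lemma quintic_chargeE u s :
  quintic_charge u s = omega_inf (vsum s) u - omega_inf (vsum s).+1 u.
Proof.
pose V n : 'cV[R[i]]_4 := \col_i omega_inf (nth 0%N [:: n; n.+1; n.+2; n.+4] i) u.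
have MV n : matM R *m V n = V n.+1.
  apply/matrixP => i j; rewrite !mxE !big_ord_recl big_ord0 !mxE /=.
  case: i => [[|[|[|[|//]]]]] ? /=; rewrite ?mul0r ?mul1r ?mulN1r ?addr0 ?add0r//.
    apply/eqP; rewrite eq_sym -subr_eq0 !opprD !opprK -(omega_inf_sum n u); apply/eqP; ring.
  by rewrite -(omega_inf_period n) addnC.
have MnV n : matM R ^+ n *m V 0%N = V n.
  elim: n => [|n IH]; first by rewrite expr0 mul1mx.
  by rewrite exprS -mulmxE -mulmxA IH MV.
rewrite /quintic_charge -mulmxA (_ : Pi_inf u = V 0%N); last by apply/matrixP => i j; rewrite !mxE.
rewrite MnV mxE !big_ord_recl big_ord0 !mxE /=.
by rewrite mul1r mulN1r !mul0r !addr0.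
Qed.

Definition omega_coef k n : R := Gamma (n%:R + k%:R / 5) ^+ 5 / Gamma (5 * n + k)%:R.

Definition omega_scale : R[i] := - (1 / 5) * (1 / (2 * pi%:C * 'i) ^+ 4).

(** With [n.+1] the Gamma argument [a] is at least 1, as [Gamma_ratio_le] demands, and the
    denominator is [Gamma (5 * a)]. *)
Lemma omega_coef_bound k n : `|omega_coef k n.+1| <= 1 + expR 2.
Proof.
have a1 : 1 <= n.+1%:R + k%:R / 5 :> R.
  by rewrite -[leLHS]addr0 lerD ?divr_ge0// ler1n.
rewrite /omega_coef (_ : (5 * n.+1 + k)%:R = 5 * (n.+1%:R + k%:R / 5)).
  by have /andP[c0 c1] := Gamma_ratio_le a1; rewrite ger0_norm.
by rewrite natrD natrM; field.
Qed.

Lemma omega_tilde_head k u : `|u| <= (2^-1)%:C ->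
  `|omega_tilde k u - omega_scale * (omega_coef k 0)%:C * u ^+ k| <=
  `|omega_scale| * (4 * (1 + expR 2))%:C * `|u| ^+ 2.
Proof.
move=> u12; rewrite /omega_tilde -/omega_scale -mulrA -mulrBr normrM -mulrA ler_wpM2l//.
exact: (power_series_head k (omega_coef_bound k) u12).
Qed.

(** The constant [A] of the leading term [A u xi^n]. Four factors [1 - xi] come from [omega_inf],
    the fifth from the difference of consecutive periods. *)
Definition charge_scale : R[i] := (1 - xi) ^+ 5 * (omega_scale * (omega_coef 1 0)%:C).

Lemma charge_scale_neq0 : charge_scale != 0.
Proof.
have cneq0 (x : R) : x != 0 -> x%:C != 0 by rewrite (inj_eq (@complexI R)).
have i0 : 'i != 0 :> R[i] by rewrite eq_complex/= oner_eq0 andbF.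
have S0 : omega_scale != 0.
  apply: mulf_neq0; first by rewrite oppr_eq0 mul1r invr_eq0 pnatr_eq0.
  rewrite mul1r invr_eq0 expf_neq0//; apply: mulf_neq0 i0.
  by apply: mulf_neq0; [rewrite pnatr_eq0 | rewrite cneq0// gt_eqF// pi_gt0].
have c0 : omega_coef 1 0 != 0.
  rewrite /omega_coef add0r muln0 add0n gt_eqF//.
  by apply: divr_gt0; [apply: exprn_gt0|]; apply: Gamma_gt0; lra.
apply: mulf_neq0; last by apply: mulf_neq0 S0 _; exact: cneq0.
by rewrite expf_neq0// subr_eq0 eq_sym xi_neq1.
Qed.

(** Only [k = 1] contributes to first order in [u]. The bound is uniform in [n] because [n] enters
    through powers of [xi], of modulus 1. *)
Lemma omega_inf_head : exists C : R, forall u n, `|u| <= (2^-1)%:C ->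
  `|omega_inf n u - omega_inf n.+1 u - charge_scale * u * xi ^+ n| <= C%:C * `|u| ^+ 2.
Proof.
pose tail k u : R[i] := omega_tilde k u - (k == 1)%N%:R * omega_scale * (omega_coef 1 0)%:C * u.
(* The condition [0 < k] stands under the existential so that [choice] gives a bound indexed by all
   naturals. *)
have tailB k : exists B : R, (0 < k)%N -> forall u, `|u| <= (2^-1)%:C ->
    `|(1 - xi ^+ k) ^+ 5| * `|tail k u| <= B%:C * `|u| ^+ 2.
  have [e e0 eE] := normcE_real ((1 - xi ^+ k) ^+ 5); rewrite eE.
  have [S S0 SE] := normcE_real omega_scale.
  (* The first summand bounds the series beyond its first term; the second bounds that term for
     [k >= 2], where [|u| ^+ k <= |u| ^+ 2]. *)
  exists (e * (S * (4 * (1 + expR 2)) + S * `|omega_coef k 0|)) => k0 u u12.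
  rewrite rmorphM -mulrA ler_wpM2l ?lecR// rmorphD mulrDl.
  have := omega_tilde_head k u12; rewrite SE -rmorphM => tB.
  have [k1|k1] := eqVneq k 1%N.
    rewrite -[leLHS]addr0; apply: lerD; last first.
      by apply: mulr_ge0; [rewrite lecR mulr_ge0 | exact/exprn_ge0/normr_ge0].
    by rewrite k1 expr1 in tB; rewrite /tail k1 eqxx mul1r.
  have -> : tail k u = (omega_tilde k u - omega_scale * (omega_coef k 0)%:C * u ^+ k) +
      omega_scale * (omega_coef k 0)%:C * u ^+ k.
    by rewrite subrK /tail (negPf k1) !mul0r subr0.
  apply: le_trans (ler_normD _ _) _; apply: lerD; first exact: tB.
  rewrite 2!normrM SE normc_real -rmorphM; apply: ler_wpM2l; first by rewrite lecR mulr_ge0.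
  rewrite normrX.
  have -> : k = (2 + (k - 2))%N by lia.
  rewrite exprD ler_piMr ?exprn_ge0// exprn_ile1// (le_trans u12)// lecR invf_le1//.
  by rewrite ler1n.
have [B BP] := choice tailB; exists (\sum_(1 <= k < 5) B k) => u n u12.
have -> : omega_inf n u - omega_inf n.+1 u - charge_scale * u * xi ^+ n =
    \sum_(1 <= k < 5) (1 - xi ^+ k) ^+ 5 * tail k u * xi ^+ (k * n).
  have -> : charge_scale * u * xi ^+ n = \sum_(1 <= k < 5) (1 - xi ^+ k) ^+ 5 *
      ((k == 1)%N%:R * omega_scale * (omega_coef 1 0)%:C * u) * xi ^+ (k * n).
    rewrite big_ltn// [X in _ + X]big_nat big1 => [|k /andP[k1 _]].
      by rewrite addr0 eqxx mul1r mul1n expr1 /charge_scale -!mulrA.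
    by rewrite gtn_eqF// !mul0r mulr0 mul0r.
  (* The summand [k = 5] is split off; it vanishes because [xi ^+ 5 = 1]. *)
  rewrite !omega_infE -sumrB big_nat_recr//=.
  rewrite {3 4}/omega_weight xi5 subrr expr0n/= !mul0r subr0 addr0 -sumrB.
  apply: eq_bigr => k _; rewrite /tail /omega_weight.
  rewrite (exprS (xi ^+ k) n) -exprM.
  move: (xi ^+ k) (xi ^+ (k * _)) (omega_tilde k u) (_ * u) => z zn w c.
  by ring.
apply: le_trans (ler_norm_sum _ _ _) _.
rewrite rmorph_sum mulr_suml !big_nat; apply: ler_sum => k /andP[k0 _].
by rewrite 2!normrM (normrX _ xi) norm_expi expr1n mulr1; exact: BP.
Qed.
End QuinticCharge.

(** * Polar coordinates and the choice of phases *)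

Section Polar.
Variable R : realType.
Implicit Types z w : R[i].

Lemma polar z : z != 0 -> exists2 m : R, 0 < m & exists t, z = m%:C * expi t.
Proof.
move=> z0; have [m m0 zm] := normcE_real z.
have {}m0 : 0 < m.
  by rewrite lt_def m0 andbT; apply: contra_neq z0 => mz; apply/normr0_eq0; rewrite zm mz.
exists m => //; case: z z0 zm => a b _; rewrite normc_def/= => -[/esym mE].
have m2 : a ^+ 2 + b ^+ 2 = m ^+ 2 by rewrite mE sqr_sqrtr// addr_ge0 ?sqr_ge0.
have m_neq0 : m != 0 by rewrite gt_eqF.
have abm : (a / m) ^+ 2 + (b / m) ^+ 2 = 1.
  by rewrite !expr_div_n -mulrDl m2 divff// expf_neq0.
have a1 : -1 <= a / m <= 1.
  by rewrite -ler_norml -(@ler_pXn2r _ 2) ?nnegrE// expr1n real_normK ?num_real// -abm lerDl sqr_ge0.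
have sE : sin (acos (a / m)) = `|b / m|.
  by rewrite sin_acos// -abm addrC addKr sqrtr_sqr.
have [b0|b0] := leP 0 (b / m).
  exists (acos (a / m)); rewrite /expi sE acosK ?in_itv// ger0_norm//; simpc.
  by rewrite !(mulrC m) !divfK.
exists (- acos (a / m)); rewrite /expi cosN sinN sE acosK ?in_itv// ltr0_norm// opprK; simpc.
by rewrite !(mulrC m) !divfK.
Qed.

Lemma polar_near1 (e : R) : 0 < e -> exists2 d : R, 0 < d &
  forall w, `|w - 1| <= d%:C ->
    exists2 m : R, 0 < m & exists2 t : R, `|t| < e & w = m%:C * expi t.
Proof.
move=> e0; have /cvgrPdist_lt := @continuous_atan R 0.
move=> /(_ e e0) /nbhs_ballP[d0/= d00 dP].
(* The first bound keeps the real part at least 1/2; the second then makes the slope [b / a] smaller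
   than [d0]. *)
exists (Num.min (2^-1) (d0 / 4)); first by rewrite lt_min invr_gt0 ltr0n divr_gt0.
move=> w wd; have := norm_Re_le wd; have := norm_Im_le wd; case: w wd => a b _ /=.
rewrite subr0 !le_min => /andP[_ bd] /andP[a1 _].
have a12 : 2^-1 <= a by move: a1; rewrite ler_norml => /andP[+ _]; lra.
have a0 : 0 < a by lra.
have t_lt : `|atan (b / a)| < e.
  rewrite -normrN -[- atan _]add0r -{1}atan0; apply: dP.
  rewrite /ball/= sub0r normrN normrM normfV (gtr0_norm a0) ltr_pdivrMr//.
  by apply: le_lt_trans bd _; nra.
have c0 : 0 < cos (atan (b / a)).
  by rewrite cos_atan invr_gt0 sqrtr_gt0 ltr_wpDr ?sqr_ge0.
exists (a / cos (atan (b / a))); first exact: divr_gt0.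
exists (atan (b / a)) => //; rewrite /expi; simpc.
have : tan (atan (b / a)) = b / a by rewrite atanK.
rewrite /tan => tE; rewrite divfK ?gt_eqF// mulrAC -mulrA tE mulrC divfK ?gt_eqF//.
Qed.
End Polar.

(** The phases are [al + 2 pi n / 5] with errors below [pi / 5], where [al] is the argument of
    [A u]; consecutive gaps thus lie strictly between 0 and [4 pi / 5]. *)
Lemma quintic_charge_polar (R : realType) : exists2 d : R, 0 < d &
  forall u : R[i], u != 0 -> `|u| <= d%:C ->
  exists mass theta : nat -> R,
    [/\ forall n, 0 < mass n, forall n, theta n < theta n.+1,
        forall n, theta n.+1 - theta n < pi
      & forall s, quintic_charge u s = (mass (vsum s))%:C * expi (theta (vsum s))].
Proof.
have pi0 := pi_gt0 R.
have [e e0 near1] := polar_near1 (divr_gt0 pi0 (ltr0Sn R 4)).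
have [C headC] := omega_inf_head R.
have [a0 a0_ge0 aE] := normcE_real (charge_scale R).
have a_gt0 : 0 < a0.
  rewrite lt_def a0_ge0 andbT; apply: contra_neq (charge_scale_neq0 R) => a00.
  by apply/normr0_eq0; rewrite aE a00.
have C1 : 0 < `|C| + 1 by rewrite ltr_wpDl.
(* The relative error [C |u| / a0] must not exceed [e]; [|C| + 1] is positive whatever the sign of
   [C]. *)
exists (Num.min (2^-1) (e * a0 / (`|C| + 1))).
  by rewrite lt_min invr_gt0 ltr0n divr_gt0// mulr_gt0.
move=> u u0; have [t t0 ut] := normcE_real u; rewrite ut lecR le_min => /andP[t12 tC].
have {}t0 : 0 < t.
  by rewrite lt_def t0 andbT; apply: contra_neq u0 => t00; apply/normr0_eq0; rewrite ut t00.
have [m m0 [al Au]] := polar (mulf_neq0 (charge_scale_neq0 R) u0).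
have /choice[p pP] n : exists p : R * R, [/\ 0 < p.1, `|p.2| < pi / 5 &
    omega_inf n u - omega_inf n.+1 u = charge_scale R * u * xi R ^+ n * (p.1%:C * expi p.2)].
  set b := charge_scale R * u * xi R ^+ n.
  have nb : `|b| = (a0 * t)%:C.
    by rewrite /b 2!normrM normrX norm_expi expr1n mulr1 aE ut rmorphM.
  have b0 : b != 0 by rewrite -normr_eq0 nb (inj_eq (@complexI R)) gt_eqF// mulr_gt0.
  have [|rho rho0 [de de_lt E]] := near1 ((omega_inf n u - omega_inf n.+1 u) / b).
    rewrite -[X in _ - X](divff b0) -mulrBl normrM normfV nb.
    rewrite ler_pdivrMr ?(ltcR 0) ?mulr_gt0//; apply: le_trans (headC u n _) _.
      by rewrite ut lecR.
    rewrite ut -rmorphXn -!rmorphM lecR.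
    move: tC; rewrite ler_pdivlMr// => tC.
    by have := ler_norm C; nra.
  by exists (rho, de); split=> //=; rewrite -E mulrC divfK.
exists (fun n => m * (p n).1), (fun n => al + n%:R * (2 * pi / 5) + (p n).2).
have bnd n : - (pi / 5) < (p n).2 < pi / 5 by have [_ + _] := pP n; rewrite ltr_norml.
split.
- by move=> n; have [p1 _ _] := pP n; rewrite mulr_gt0.
- move=> n; have /andP[h1 h2] := bnd n; have /andP[h3 h4] := bnd n.+1.
  by rewrite -natr1; nra.
- move=> n; have /andP[h1 h2] := bnd n; have /andP[h3 h4] := bnd n.+1.
  by rewrite -natr1; nra.
- move=> s; have [_ _] := pP (vsum s); rewrite quintic_chargeE => ->.
  by rewrite Au /xi expiX !expiD rmorphM; ring.
Qed.

Theorem theorem1p2 (R : realType)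
  (* D^b_G(Coh X), D^b(Coh X) and FS(F) *)
  (DG DX FS : shift_category)
  (* the two equivalences *)
  (Phi : functor (Db R[i]) DG) (hPhi : is_equivalence Phi)
  (Psi : functor (Db R[i]) FS) (hPsi : is_equivalence Psi)
  (* forgetting the equivariance *)
  (forget : functor DG DX)
  (hforget : nat_isom (comp_functor forget (shift_functor DG)) (comp_functor (shift_functor DX) forget))
  (* O_X and the autoequivalence tau *)
  (OX : DX)
  (tau : functor DX DX) (htau : is_equivalence tau)
  (htau_shift : nat_isom (comp_functor tau (shift_functor DX)) (comp_functor (shift_functor DX) tau))
  (htau5 : nat_isom (functor_pow tau 5) (functor_pow (shift_functor DX) 2))
  (* forgetting the equivariance, the simple s becomes tau^(-sum s_i) O_X *)
  (hsimple : forall s : vertex,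
     isom (functor_pow tau (vsum s) (forget (Phi (heart (simple R[i] s))))) OX)
  (* the sheaves O_X, O_X(1), Omega(2), Omega^2(3), Omega^3(4) *)
  (beilinson : 'I_5 -> DX)
  (hbeilinson : forall i : 'I_5, isom_to_shift (functor_pow tau i OX) (beilinson i))
  (* the Lagrangian vanishing cycles *)
  (vanishing_cycle : FS -> Prop)
  (hsimple_vc : forall s : vertex,
     exists2 L, vanishing_cycle L & isom (Psi (heart (simple R[i] s))) L)
  (hvc_simple : forall L, vanishing_cycle L ->
     exists s : vertex, isom (Psi (heart (simple R[i] s))) L)
  (* a branch of x^(-1/5) *)
  (root5 : R[i] -> R[i]) (hroot5 : forall x, x != 0 -> root5 x ^+ 5 = x^-1) :
  exists2 r : R, 0 < r &
  forall x : R[i], r%:C < `|x| ->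
  exists S : stability R,
    (forall s : vertex, central_charge S (simple R[i] s) = quintic_charge (root5 x) s) /\
    (forall E : rep R[i], stable S E ->
       (exists2 L, vanishing_cycle L & isom (Psi (heart E)) L) /\
       (exists (B : DG) (i : 'I_5),
          isom (forget B) (beilinson i) /\ isom_to_shift (Phi (heart E)) B)).
Proof.
have [d d0 dP] := quintic_charge_polar R.
(* As [root5 x ^+ 5 = x^-1], this radius forces [root5 x] to have modulus at most [d]. *)
exists (d ^- 5) => [|x xr]; first by rewrite invr_gt0 exprn_gt0.
have dV0 : 0 < (d ^- 5)%:C :> R[i] by rewrite (ltcR 0) invr_gt0 exprn_gt0.
have x0 : x != 0 by rewrite -normr_gt0 (lt_trans dV0 xr).
have u5 := hroot5 x x0.
have u0 : root5 x != 0.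
  by apply: contra_neq (invr_neq0 x0) => ux; rewrite -u5 ux expr0n.
have ud : `|root5 x| <= d%:C.
  have u5d : `|root5 x| ^+ 5 <= d%:C ^+ 5.
    rewrite -normrX u5 normfV invf_ple ?posrE ?normr_gt0//.
      by rewrite -rmorphXn -fmorphV ltW.
    by rewrite -rmorphXn (ltcR 0) exprn_gt0.
  have dge0 : 0 <= d%:C :> R[i] by rewrite (lecR 0) ltW.
  by move: u5d; rewrite ler_pXn2r// nnegrE.
have [mass [theta [mass0 theta_lt theta_gap chargeE]]] := dP _ u0 ud.
exists (level_stability mass0 theta_lt theta_gap); split=> [s|E].
  by rewrite /= level_charge_simple chargeE.
move=> /level_stable_simple[s /heart_isom Es]; split.
  have [L vL sL] := hsimple_vc s; exists L => //.
  exact: isom_trans (functor_isom Psi Es) sL.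
apply: (simple_beilinson hforget htau5 hbeilinson (n := vsum s)).
apply: isom_trans (hsimple s).
exact: functor_isom _ (functor_isom forget (functor_isom Phi Es)).
Qed.
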